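(* Given a weighted graph $G=(V,E,w)$ on $n$ vertices, where the non-zero edge weights are in the range $[1,W]$, and $1/n\le\varepsilon\le1/30$, there exists a (randomized) cut sketch of size $\tilde O(\frac{n}{\varepsilon}\log\log W)$ bits. Specifically, for every query $S\subset V$, the sketch produces a $1+O(\varepsilon)$ approximation to $w(S,\bar S)$ with probability at least $7/9$.
   Context: $w:E\to\mathbb{R}_+$ are edge weights, and $w(S,\bar S)=\sum_{e\in E:|e\cap S|=1}w(e)$ is the cut weight of $S\subset V$, $\bar S=V\setminus S$. A cut sketch consists of a randomized sketching algorithm, which maps $G$ to a data structure (the sketch), and an estimation algorithm, which given only the sketch and a query $S\subset V$ (without access to $G$) outputs an estimate of $w(S,\bar S)$. For $\rho\ge1$, $\hat a>0$ is a $\rho$-approximation to $a>0$ if $\hat a/a\in[1/\rho,\rho]$. $\tilde O(\cdot)$ hides factors polylogarithmic in $n$. *)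

(* Defs.v *)
From mathcomp Require Import all_boot all_order all_algebra.
From mathcomp Require Import all_classical all_reals all_analysis.

Set Implicit Arguments.
Unset Strict Implicit.
Unset Printing Implicit Defensive.

Import Order.TTheory GRing.Theory Num.Theory.
Local Open Scope ring_scope.

(* Edges are two-element sets of vertices; the values of [weight] outside
   [edges] play no role. *)
Record wgraph (R : realType) (V : finType) := WGraph {
  edges : {set {set V}};
  weight : {set V} -> R;
  edges_card2 : forall e, e \in edges -> #|e| = 2%N;
  weight_ge0 : forall e, e \in edges -> 0 <= weight e }.

Definition cut_weight (R : realType) (V : finType) (G : wgraph R V)
    (S : {set V}) : R :=
  \sum_(e in edges G | #|e :&: S| == 1%N) weight G e.

Definition weights_in_range (R : realType) (V : finType) (W : R)
    (G : wgraph R V) : Prop :=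
  forall e, e \in edges G -> weight G e != 0 -> 1 <= weight G e <= W.

Record fdist (R : realType) (T : finType) := FDist {
  pmf : T -> R;
  pmf_ge0 : forall x, 0 <= pmf x;
  pmf_sum1 : \sum_x pmf x = 1 }.

Definition prob (R : realType) (T : finType) (d : fdist R T) (A : pred T) : R :=
  \sum_(x | A x) pmf d x.

(* A sketch of [s] bits. The randomized sketching algorithm is given by the law
   of its output on each input graph; the estimation algorithm is deterministic
   and sees only the bits of the sketch and the query. *)
Record cut_sketch (R : realType) (V : finType) (s : nat) := CutSketch {
  sketch : wgraph R V -> fdist R (s.-tuple bool);
  estimate : s.-tuple bool -> {set V} -> R }.

Definition approximation (R : realType) (rho ahat a : R) : bool :=
  [&& 0 < ahat, 0 < a & rho^-1 <= ahat / a <= rho].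

(* The ratio is undefined for a cut of weight 0 (for instance the cut of the
   empty set); the only multiplicative approximation of 0 is 0 itself. *)
Definition good_estimate (R : realType) (rho ahat a : R) : bool :=
  if a == 0 then ahat == 0 else approximation rho ahat a.

(* log log W is at most 0 for small W, where the asymptotic notation stands for
   a positive quantity; it is truncated from below at 1. *)
Definition loglog (R : realType) (W : R) : R := Num.max 1 (ln (ln W)).

(* Main.v *)
Require Import Defs.
From mathcomp Require Import all_boot all_order all_algebra.
From mathcomp Require Import all_classical all_reals all_analysis.
From mathcomp Require Import ring lra zify.

Set Implicit Arguments.
Unset Strict Implicit.
Unset Printing Implicit Defensive.

Import Order.TTheory GRing.Theory Num.Theory.
Local Open Scope ring_scope.

(* Let [B = n ^ 3], and let [B ^ j] be the scale of the heaviest edge crossing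
   the query [S].  Edges lighter than [B ^ (j - 1)] are negligible, and [S] cuts
   no edge heavier than [B ^ (j + 1)], so the cut can be read off the graph in
   which those edges are contracted and weights are rounded to multiples of
   [B ^ (j - 1)].  Over all scales these contracted graphs have only [O(n)]
   non-isolated vertices, and their weights are integers of polynomial size.

   Each contracted graph is an edge-disjoint sum of [O(log n)] graphs whose
   clusters satisfy [min (vol A) (vol (U \ A)) <= q * cut A] for [q = O(log n)].
   In such a cluster the cut of the lighter side [A] is [vol A] minus the weight
   inside [A].  The degrees are stored exactly, and the inner edges are sampled
   with probability [min (1, m g (1 / d_u + 1 / d_v))], where [m] is about
   [q / eps]: this keeps [O(m)] edges per vertex, and the variance of the inner
   weight is at most [(vol A / m) ^ 2 <= (q / m) ^ 2 * cut ^ 2]. Chebyshev's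
   inequality for the estimate and Markov's inequality for the number of sampled
   edges each lose probability [1 / 9]. *)

(** * Encoding sparse functions in bits *)

Section SparseEncoding.
Local Open Scope nat_scope.

Lemma leq_card_embedding (A B : finType) (b0 : B) (X : {set A}) :
  #|X| <= #|B| -> exists e : A -> B, {in X &, injective e}.
Proof.
move=> XB; have [->|[x0 Xx0]] := set_0Vmem X.
  by exists (fun=> b0) => x; rewrite inE.
exists (fun x => enum_val (widen_ord XB (enum_rank_in Xx0 x))) => x y Xx Xy.
move/enum_val_inj/(congr1 val) => /= /val_inj.
exact: (enum_rank_in_inj Xx Xy).
Qed.

(** A function with at most [N] values other than [d0] can be read back from a list of [N] key-value
    pairs. Hence there are at most [(#|K| * #|D|) ^ N] such functions, few enough to inject into the
    bit strings of length [s]. *)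
Lemma sparse_encoding (K D : finType) (k0 : K) (d0 : D) (N s : nat) :
  (#|K| * #|D|) ^ N <= 2 ^ s ->
  exists (enc : {ffun K -> D} -> s.-tuple bool)
         (dec : s.-tuple bool -> {ffun K -> D}),
    forall f : {ffun K -> D}, #|[set k | f k != d0]| <= N -> dec (enc f) = f.
Proof.
move=> Hs; pose X := [set f : {ffun K -> D} | #|[set k | f k != d0]| <= N].
pose read (t : N.-tuple (K * D)) : {ffun K -> D} :=
  [ffun k => if [pick d | (k, d) \in t] is Some d then d else d0].
have XN : #|X| <= (#|K| * #|D|) ^ N.
  rewrite -card_prod -card_tuple -cardsT.
  apply: leq_trans (leq_imset_card read [set: _]); apply: subset_leq_card.
  apply/fintype.subsetP => f; rewrite inE => fN.
  pose l := [seq (k, f k) | k <- enum [set k | f k != d0]].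
  (* Padding repeats a true pair of [f], so it adds no false value. *)
  pose pad := nseq (N - size l) (k0, f k0).
  have szl : size l <= N by rewrite size_map -cardE.
  have szt : size (l ++ pad) == N by rewrite size_cat size_nseq subnKC.
  have graph k d : (k, d) \in l ++ pad -> d = f k.
    rewrite mem_cat => /orP[/mapP[k' _ [-> ->]] //|].
    by rewrite mem_nseq => /andP[_ /eqP[-> ->]].
  apply/imsetP; exists (Tuple szt) => //; apply/ffunP => k; rewrite ffunE.
  case: pickP => [d /graph //|none].
  apply/eqP/negPn/negP => fk.
  have /negP[] := negbT (none (f k)); rewrite memtE mem_cat; apply/orP; left.
  by apply/mapP; exists k; rewrite // mem_enum inE.
have [|enc enc_inj] := @leq_card_embedding _ (s.-tuple bool) [tuple of nseq s true] X.
  by rewrite card_tuple card_bool (leq_trans XN).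
exists enc, (fun t => odflt [ffun=> d0] [pick f in X | enc f == t]) => f fN.
have fX : f \in X by rewrite inE.
case: pickP => [f' /andP[f'X /eqP /enc_inj ->] //|/(_ f)].
by rewrite fX eqxx.
Qed.

End SparseEncoding.

(** * Expander decomposition *)

Section ExpanderDecomposition.
Local Open Scope nat_scope.
Variables (V : finType) (v0 : V).
Implicit Types (g h : V -> V -> nat) (c : V -> V) (S : {set V}) (z : V).

Definition degree h u := \sum_v h u v.

Definition total_weight h := \sum_u degree h u.

Definition cluster_vol h c z S := \sum_(u in S | c u == z) degree h u.

Definition cluster_cut h c z S :=
  \sum_(u in S | c u == z) \sum_(v in ~: S) h u v.

Definition is_expander q h c :=
  forall z S, minn (cluster_vol h c z S) (cluster_vol h c z (~: S))
              <= q * cluster_cut h c z S.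

Definition inner h c u v := (c u == c v) * h u v.

Definition outer h c u v := (c u != c v) * h u v.

(* Splitting off a sparse [A] from a cluster costs [2 q cut A < 2 vol A] in the
   first term, and gains at least [2 vol A] in the second because the cluster of
   each vertex of [A] is halved: a minimiser has no sparse cut. *)
Definition potential q h c :=
  q * total_weight (outer h c) +
  2 * \sum_u degree h u * trunc_log 2 #|[set v | c v == c u]|.

(** Labels are themselves vertices: if all were used, [c] would be a surjection of a finite set onto
    itself, hence injective. *)
Lemma fresh_label c u v : u != v -> c u = c v -> exists y, forall x, c x != y.
Proof.
move=> uv cuv.
have [/existsP[y /forallP Hy]|/existsPn H] := boolP [exists y, [forall x, c x != y]].
  by exists y.
have surj y : y \in codom c.
  by have /forallPn[x] := H y; rewrite negbK => /eqP <-; apply: codom_f.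
have /injectiveP inj : injectiveb c.
  rewrite /injectiveb /dinjectiveb; apply/card_uniqP.
  by rewrite (size_codom c); apply: eq_card => y; rewrite surj.
by move/eqP: uv; case; apply: inj.
Qed.

Lemma cluster_cutC g c z S :
  (forall u v, g u v = g v u) -> (forall u v, 0 < g u v -> c u = c v) ->
  cluster_cut g c z (~: S) = cluster_cut g c z S.
Proof.
move=> gC gc; rewrite /cluster_cut finset.setCK.
under eq_bigr do rewrite big_mkcond.
under [in RHS]eq_bigr do rewrite big_mkcond.
rewrite big_mkcond [RHS]big_mkcond.
transitivity (\sum_u \sum_v if [&& u \notin S, c u == z & v \in S] then g u v else 0).
  apply: eq_bigr => u _; rewrite inE.
  case: ifP => [/andP[-> ->] //|/negbT]; rewrite negb_and => H.
  by rewrite big1 // => v _; case: ifP => // /and3P[Hu Hc _]; rewrite Hu Hc in H.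
rewrite exchange_big; apply: eq_bigr => u _ /=.
case: ifP => [/andP[Hu Hc]|/negbT Hu].
  apply: eq_bigr => v _; rewrite Hu inE andbT gC.
  case: (posnP (g u v)) => [->|/gc Hg]; first by rewrite !if_same.
  by rewrite -Hg Hc andbT.
rewrite big1 // => v _; case: ifP => // /and3P[Hv Hz HuS].
rewrite gC; case: (posnP (g u v)) => // /gc Hg.
by rewrite HuS Hg Hz in Hu.
Qed.

Lemma potential_split q h c z S :
  (forall u v, h u v = h v u) ->
  (#|[set v in S | c v == z]|.*2 <= #|[set v | c v == z]|) ->
  q * cluster_cut (inner h c) c z S < cluster_vol (inner h c) c z S ->
  exists c', potential q h c' < potential q h c.
Proof.
move=> hC small sparse.
set A := [set v in S | c v == z] in small.
have inA u : (u \in A) = (u \in S) && (c u == z) by rewrite inE.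
have A0 : 0 < #|A|.
  rewrite card_gt0; apply: contraTneq sparse => A0.
  rewrite /cluster_vol big_pred0 ?ltn0 // => u.
  by rewrite -inA A0 inE.
have [y Hy] : exists y, forall x, c x != y.
  have : 1 < #|[set v | c v == z]| by lia.
  case/card_gt1P => u [v []]; rewrite !inE => /eqP Hu /eqP Hv uv.
  by apply: (fresh_label uv); rewrite Hu.
pose c' v := if v \in A then y else c v.
exists c'.
have volA : cluster_vol (inner h c) c z S <= \sum_(u in A) degree h u.
  rewrite /cluster_vol (eq_bigl (fun u => u \in A)); last by move=> u; rewrite inA.
  apply: leq_sum => u _; apply: leq_sum => v _; rewrite /inner.
  by case: (c u == c v); rewrite ?mul1n.
(* Edges from [A] to the rest of its cluster become outer, and each is counted in both
   orientations. *)
have cross : total_weight (outer h c') =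
    total_weight (outer h c) + 2 * cluster_cut (inner h c) c z S.
  pose F u v := ((u \in A) && (v \notin S)) * inner h c u v.
  have FE : \sum_u \sum_v F u v = cluster_cut (inner h c) c z S.
    rewrite /cluster_cut [RHS](eq_bigl (fun u => u \in A)); last by move=> u; rewrite inA.
    rewrite [RHS]big_mkcond; apply: eq_bigr => u _ /=.
    case: ifP => Hu; last by apply: big1 => v _; rewrite /F Hu.
    rewrite [RHS]big_mkcond; apply: eq_bigr => v _; rewrite /F Hu inE.
    by case: (v \in S); rewrite ?mul1n ?mul0n.
  rewrite mul2n -addnn -{1}FE -FE [X in _ = _ + (_ + X)]exchange_big.
  rewrite /total_weight /degree -!big_split /=; apply: eq_bigr => u _.
  rewrite -!big_split /=; apply: eq_bigr => v _.
  rewrite /F /outer /inner /c' (hC v u) !inA.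
  have yc x : (y == c x) = false by rewrite eq_sym (negbTE (Hy x)).
  have cy x : (c x == y) = false by rewrite (negbTE (Hy x)).
  case: (u \in S); case: (v \in S); case: (eqVneq (c u) z) => cu;
    case: (eqVneq (c v) z) => cv; rewrite /= ?yc ?cy ?eqxx ?cu ?cv ?eqxx
      ?(negbTE cu) ?(negbTE cv) ?[z == _]eq_sym ?(negbTE cu) ?(negbTE cv);
    by rewrite ?mul0n ?mul1n ?addn0 ?add0n.
(* On [A] the new cluster is [A], at most half of the old one, so the logarithm drops by at least 1;
   other clusters can only shrink. *)
have logs : \sum_u degree h u * trunc_log 2 #|[set v | c' v == c' u]|
    + \sum_(u in A) degree h u
    <= \sum_u degree h u * trunc_log 2 #|[set v | c v == c u]|.
  rewrite [X in _ + X]big_mkcond -big_split; apply: leq_sum => u _ /=.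
  case: ifP => Hu.
    have -> : [set v | c' v == c' u] = A.
      apply/setP => v; rewrite inE {2}/c' Hu /c'.
      by case: ifP => Hv; [rewrite eqxx | rewrite (negbTE (Hy v))].
    have /andP[_ /eqP ->] : (u \in S) && (c u == z) by rewrite -inA.
    rewrite -[X in _ + X]muln1 -mulnDr leq_mul2l addn1 -trunc_log2_double //.
    by rewrite leq_trunc_log ?orbT.
  rewrite addn0 leq_mul2l leq_trunc_log ?orbT //.
  apply: subset_leq_card; apply/fintype.subsetP => v; rewrite !inE /c' Hu.
  by case: ifP => // _; rewrite eq_sym (negbTE (Hy u)).
rewrite /potential cross; move: sparse volA logs; nia.
Qed.

(** In a minimiser of [potential] no sparse cut survives, since one side of every cut holds at most
    half of its cluster and could be split off. Comparison with the single-cluster labelling bounds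
    [q] times the outer weight by [2 * total_weight h * trunc_log 2 #|V|]; the lower bound on [q]
    turns this into one half. *)
Lemma expander_decomposition q h :
  (forall u v, h u v = h v u) -> 0 < trunc_log 2 #|V| ->
  4 * trunc_log 2 #|V| <= q ->
  exists c, is_expander q (inner h c) c
            /\ 2 * total_weight (outer h c) <= total_weight h.
Proof.
move=> hC t0 Hq.
pose c : {ffun V -> V} :=
  [arg min_(c < [ffun=> v0] : {ffun V -> V}) potential q h c].
have cmin (c' : V -> V) : potential q h c <= potential q h c'.
  have -> : potential q h c' = potential q h (finfun c').
    rewrite /potential; congr (q * _ + 2 * _).
      apply: eq_bigr => u _; apply: eq_bigr => v _.
      by rewrite /outer !ffunE.
    apply: eq_bigr => u _; congr (_ * trunc_log _ #|pred_of_set _|).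
    by apply/setP => v; rewrite !inE !ffunE.
  by rewrite /c; case: arg_minnP => // i _; apply.
exists c; split; last first.
  have := cmin (fun=> v0); rewrite /potential.
  have -> : total_weight (outer h (fun=> v0)) = 0.
    by apply: big1 => u _; apply: big1 => v _; rewrite /outer eqxx.
  under [X in _ <= _ + 2 * X]eq_bigr => u _.
    have -> : [set v : V | v0 == v0] = [set: V] by apply/setP => v; rewrite !inE eqxx.
    rewrite cardsT; over.
  rewrite -big_distrl /= -/(total_weight h) muln0 add0n.
  move: (total_weight _) (total_weight h) (trunc_log _ _) t0 Hq => X T t t0 Hq.
  move=> /(leq_trans (leq_addr _ _)) HX.
  rewrite -(leq_pmul2l t0); have := leq_mul2r X (4 * t) q; rewrite Hq orbT; lia.
move=> z S.
have half (T : {set V}) : #|[set v in T | c v == z]|.*2 <= #|[set v | c v == z]| ->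
    cluster_vol (inner h c) c z T <= q * cluster_cut (inner h c) c z T.
  move=> small; rewrite leqNgt; apply/negP => sparse.
  have [c' Hc'] := potential_split hC small sparse.
  by have := cmin c'; rewrite leqNgt Hc'.
have cutC : cluster_cut (inner h c) c z (~: S) = cluster_cut (inner h c) c z S.
  apply: cluster_cutC => u v; rewrite /inner; first by rewrite hC eq_sym.
  by case: eqP.
have : #|[set v in S | c v == z]|.*2 <= #|[set v | c v == z]| \/
       #|[set v in ~: S | c v == z]|.*2 <= #|[set v | c v == z]|.
  have := cardsID S [set v | c v == z].
  have -> : [set v | c v == z] :&: S = [set v in S | c v == z].
    by apply/setP => v; rewrite !inE andbC.
  have -> : [set v | c v == z] :\: S = [set v in ~: S | c v == z].
    by apply/setP => v; rewrite !inE.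
  lia.
case=> /half H; rewrite geq_min; first by rewrite H.
by rewrite -cutC H orbT.
Qed.

(** Isolated vertices contribute to no volume and no cut, so they may be moved to the default label.
    Their entries in the message then become blank and cost nothing. *)
Lemma cluster_normalise q g c :
  is_expander q g c -> (forall u v, g u v = g v u) ->
  (forall u v, 0 < g u v -> c u = c v) ->
  exists c', [/\ is_expander q g c', forall u v, 0 < g u v -> c' u = c' v
               & forall u, degree g u = 0 -> c' u = v0].
Proof.
move=> exp gC gc.
pose c' u := if degree g u == 0 then v0 else c u.
have deg_gt0 u v : 0 < g u v -> degree g u != 0.
  by move=> guv; rewrite /degree (bigD1 v) //= -lt0n; lia.
have zero u v : degree g u = 0 -> g u v = 0.
  by move=> d0; case: (posnP (g u v)) => // /deg_gt0; rewrite d0.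
have swap z (S : {set V}) (F : V -> nat) : (forall u, degree g u = 0 -> F u = 0) ->
    \sum_(u in S | c' u == z) F u = \sum_(u in S | c u == z) F u.
  move=> F0; rewrite big_mkcondr [RHS]big_mkcondr; apply: eq_bigr => u _.
  by rewrite /c'; have [/F0 Fu|] := eqVneq (degree g u) 0; rewrite // Fu !if_same.
exists c'; split.
- move=> z S; rewrite /cluster_vol /cluster_cut !swap //.
    exact: exp.
  by move=> u /zero Hu; apply: big1.
- move=> u v guv; rewrite /c' (negbTE (deg_gt0 _ _ guv)).
  by rewrite gC in guv; rewrite (negbTE (deg_gt0 _ _ guv)) -(gc v u).
- by move=> u d0; rewrite /c' d0.
Qed.

(** Each level keeps the inner edges of a decomposition and hands the outer ones to the next. The
    weight left over halves each time, so it is exhausted after [L] levels. *)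
Lemma expander_hierarchy q L h :
  (forall u v, h u v = h v u) -> 0 < trunc_log 2 #|V| ->
  4 * trunc_log 2 #|V| <= q -> total_weight h < 2 ^ L ->
  exists (g : 'I_L -> V -> V -> nat) (c : 'I_L -> V -> V),
    [/\ forall u v, \sum_k g k u v = h u v,
        forall k u v, g k u v = g k v u,
        forall k u v, 0 < g k u v -> c k u = c k v,
        forall k u, degree (g k) u = 0 -> c k u = v0
      & forall k, is_expander q (g k) (c k)].
Proof.
move=> hC t0 Hq; elim: L h hC => [|L IH] h hC Htot.
  exists (fun k u v => 0), (fun k u => v0); split => // [u v|[]//].
  move: Htot; rewrite ltnS leqn0 sum_nat_eq0 => /forallP /(_ u) /=.
  by rewrite big_ord0 sum_nat_eq0 => /forallP /(_ v) /= /eqP.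
have [c [exp half]] := expander_decomposition hC t0 Hq.
have [||c' [exp' gc' c'0]] := cluster_normalise exp.
- by move=> u v; rewrite /inner hC eq_sym.
- by move=> u v; rewrite /inner; case: eqP.
have [||g [d [sumg gC gd d0 expg]]] := IH (outer h c).
- by move=> u v; rewrite /outer hC eq_sym.
- by move: Htot; rewrite expnS; lia.
exists (fun k => if unlift ord0 k is Some i then g i else inner h c),
       (fun k => if unlift ord0 k is Some i then d i else c').
split.
- move=> u v; rewrite big_ord_recl unlift_none.
  under eq_bigr do rewrite liftK.
  by rewrite sumg /inner /outer; case: eqP; rewrite ?mul1n ?mul0n ?addn0.
- by move=> k u v; case: unlift => [i|]; [exact: gC | rewrite /inner hC eq_sym].
- by move=> k u v; case: unlift => [i|]; [exact: gd | exact: gc'].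
- by move=> k u; case: unlift => [i|]; [exact: d0 | exact: c'0].
- by move=> k; case: unlift => [i|].
Qed.
End ExpanderDecomposition.

(** * Finite probability *)

Section FiniteProbability.
Variables (R : realType) (T : finType).
Implicit Types (d : fdist R T) (A B : pred T) (Y : T -> R).

Definition expect d Y : R := \sum_x Defs.pmf d x * Y x.

Lemma markov_ineq d Y t : (forall x, 0 <= Y x) -> 0 < t ->
  prob d (fun x => t <= Y x) <= expect d Y / t.
Proof.
move=> Y0 t0; rewrite ler_pdivlMr // mulr_suml /prob big_mkcond.
apply: ler_sum => x _; case: ifP => [tY|_].
  by rewrite ler_wpM2l ?Defs.pmf_ge0.
by rewrite mulr_ge0 ?Defs.pmf_ge0.
Qed.

Lemma prob_le d A B : (forall x, A x -> B x) -> prob d A <= prob d B.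
Proof.
move=> AB; rewrite /prob big_mkcond [leRHS]big_mkcond; apply: ler_sum => x _.
case: ifP => [/AB -> //|_]; case: ifP => // _; exact: Defs.pmf_ge0.
Qed.

Lemma prob_avoid2 d A B (D : pred T) :
  (forall x, ~~ A x -> ~~ B x -> D x) -> 1 - prob d A - prob d B <= prob d D.
Proof.
move=> H; rewrite -addrA -opprD lerBlDr -(Defs.pmf_sum1 d) /prob.
rewrite [X in X + _]big_mkcond [X in _ + (X + _)]big_mkcond.
rewrite [X in _ + (_ + X)]big_mkcond.
rewrite -!big_split; apply: ler_sum => x _; have p0 := Defs.pmf_ge0 d x.
move: (H x); do 3![case: ifP => _]; move=> H';
  by rewrite ?addr0 ?add0r //=; (lra || by have := H' isT isT).
Qed.

End FiniteProbability.

Section Pushforward.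
Variables (R : realType) (T U : finType) (f : T -> U) (d : fdist R T).

Let image_pmf y := \sum_(x | f x == y) Defs.pmf d x.

Let image_pmf_ge0 y : 0 <= image_pmf y.
Proof. by apply: sumr_ge0 => x _; apply: Defs.pmf_ge0. Qed.

Let image_pmf_sum1 : \sum_y image_pmf y = 1.
Proof. by rewrite -(Defs.pmf_sum1 d) (partition_big f xpredT). Qed.

Definition pushforward_dist := FDist image_pmf_ge0 image_pmf_sum1.

Lemma prob_pushforward A : prob pushforward_dist A = prob d (fun x => A (f x)).
Proof.
rewrite /prob (partition_big f A) //=; apply: eq_bigr => y Ay.
by apply: eq_bigl => x; case: eqP => [->|]; rewrite ?Ay ?andbF.
Qed.

End Pushforward.

Section BernoulliProduct.
Variables (R : realType) (I : finType) (p : I -> R).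
Hypothesis p01 : forall i, 0 <= p i <= 1.

Let bern_pmf (w : {ffun I -> bool}) := \prod_i (if w i then p i else 1 - p i).

(** Independence: the expectation of a product over coordinates factors. The moments below take all
    but one or two factors equal to 1. *)
Let bern_prod (F : I -> bool -> R) :
  \sum_w bern_pmf w * \prod_i F i (w i) =
  \prod_i (p i * F i true + (1 - p i) * F i false).
Proof.
pose G i (b : bool) := (if b then p i else 1 - p i) * F i b.
transitivity (\prod_i \sum_b G i b); last first.
  by apply: eq_bigr => i _; rewrite big_bool.
rewrite bigA_distr_bigA; apply: eq_bigr => w _.
by rewrite -big_split.
Qed.

Let bern_pmf_ge0 w : 0 <= bern_pmf w.
Proof.
apply: prodr_ge0 => i _; have /andP[p0 p1] := p01 i.
by case: ifP => _; rewrite ?subr_ge0.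
Qed.

Let bern_pmf_sum1 : \sum_w bern_pmf w = 1.
Proof.
transitivity (\sum_w bern_pmf w * \prod_(i : I) (fun _ _ => 1 : R) i (w i)).
  by apply: eq_bigr => w _; rewrite big1 ?mulr1.
rewrite (bern_prod (fun _ _ => 1)) big1 // => i _; by rewrite !mulr1 subrKC.
Qed.

Definition bernoulli_dist := FDist bern_pmf_ge0 bern_pmf_sum1.

Lemma expect_bernoulli1 i (f : bool -> R) :
  expect bernoulli_dist (fun w => f (w i)) = p i * f true + (1 - p i) * f false.
Proof.
pose F j b := if j == i then f b else 1.
transitivity (\sum_w bern_pmf w * \prod_j F j (w j)).
  apply: eq_bigr => w _; congr (_ * _).
  rewrite (bigD1 i) //= big1 ?mulr1 /F ?eqxx // => j /negbTE -> //.
rewrite bern_prod (bigD1 i) //= big1 ?mulr1 /F ?eqxx // => j /negbTE ->.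
by rewrite !mulr1 subrKC.
Qed.

Lemma expect_bernoulli2 i j (f g : bool -> R) : i != j ->
  expect bernoulli_dist (fun w => f (w i) * g (w j)) =
  (p i * f true + (1 - p i) * f false) * (p j * g true + (1 - p j) * g false).
Proof.
move=> ij; pose F k b := if k == i then f b else if k == j then g b else 1.
transitivity (\sum_w bern_pmf w * \prod_k F k (w k)).
  apply: eq_bigr => w _; congr (_ * _).
  rewrite (bigD1 i) //= (bigD1 j) 1?eq_sym //= big1 ?mulr1 /F ?eqxx.
    by rewrite [j == i]eq_sym (negbTE ij).
  by move=> k /andP[/negbTE -> /negbTE ->].
rewrite bern_prod (bigD1 i) //= (bigD1 j) 1?eq_sym //= big1 ?mulr1 /F ?eqxx.
  by rewrite [j == i]eq_sym (negbTE ij).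
by move=> k /andP[/negbTE -> /negbTE ->]; rewrite !mulr1 subrKC.
Qed.

Lemma expect_bernoulli_count :
  expect bernoulli_dist (fun w => #|[set i | w i]|%:R) = \sum_i p i.
Proof.
transitivity (\sum_i expect bernoulli_dist (fun w => (w i)%:R)).
  rewrite exchange_big; apply: eq_bigr => w _; rewrite -mulr_sumr; congr (_ * _).
  rewrite -sum1_card natr_sum [LHS]big_mkcond; apply: eq_bigr => i _.
  by rewrite inE; case: (w i).
apply: eq_bigr => i _; rewrite (expect_bernoulli1 i (fun b => b%:R)).
by rewrite mulr1 mulr0 addr0.
Qed.

(** The off-diagonal terms vanish because distinct coordinates are independent and centred. *)
Lemma expect_bernoulli_sqr (a : I -> R) :
  expect bernoulli_dist (fun w => (\sum_i a i * ((w i)%:R - p i)) ^+ 2) =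
  \sum_i a i ^+ 2 * (p i * (1 - p i)).
Proof.
pose X i (b : bool) := a i * (b%:R - p i).
transitivity (\sum_i \sum_j expect bernoulli_dist (fun w => X i (w i) * X j (w j))).
  rewrite /expect; under [RHS]eq_bigr do rewrite exchange_big.
  rewrite [RHS]exchange_big; apply: eq_bigr => w _.
  rewrite expr2 mulr_suml mulr_sumr; apply: eq_bigr => i _.
  by rewrite mulr_sumr mulr_sumr.
apply: eq_bigr => i _; rewrite (bigD1 i) //= big1 ?addr0.
  rewrite (expect_bernoulli1 i (fun b => X i b * X i b)) /X /=; ring.
move=> j ji; rewrite expect_bernoulli2 1?eq_sym // /X /=; ring.
Qed.

End BernoulliProduct.

(** * Sampling inside clusters *)

Section ClusterEstimate.
Variables (R : realType) (V : finType) (m : nat).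
Implicit Types (g e : V -> V -> nat) (c : V -> V) (d : V -> nat) (S : {set V}).

(** Here [a] and [b] are the degrees of the two ends. The rate depends only on data kept in the
    sketch, so the estimator can recompute it. *)
Definition keep_prob (w a b : nat) : R :=
  Num.min 1 (m%:R * w%:R * (a%:R^-1 + b%:R^-1)).

Lemma keep_prob_ge0 w a b : 0 <= keep_prob w a b.
Proof. by rewrite /keep_prob le_min ler01 !mulr_ge0 // addr_ge0 ?invr_ge0. Qed.

Lemma keep_prob_le1 w a b : keep_prob w a b <= 1.
Proof. by rewrite /keep_prob ge_min lexx. Qed.

Lemma keep_prob0 a b : keep_prob 0 a b = 0.
Proof. by rewrite /keep_prob mulr0 mul0r min_r ?ler01. Qed.

Lemma keep_prob_gt0 w a b : (0 < m)%N -> (0 < w)%N -> (0 < a)%N ->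
  0 < keep_prob w a b.
Proof.
move=> m0 w0 a0; rewrite /keep_prob lt_min ltr01 !mulr_gt0 ?ltr0n //.
by rewrite ltr_pwDl ?invr_gt0 ?ltr0n ?invr_ge0.
Qed.

(** For a rate [p = w * t] below 1 the left side is [p * (1 - p) / t ^ 2], at most
    [1 / t ^ 2 = (a * b / (m * (a + b))) ^ 2], and [a * b <= (a + b) ^ 2]. The product [a * b] is
    chosen because it sums over a cluster to the square of a volume. *)
Lemma keep_prob_variance (w a b : nat) : (0 < m)%N -> (0 < a)%N -> (0 < b)%N ->
  (w%:R / keep_prob w a b) ^+ 2 * (keep_prob w a b * (1 - keep_prob w a b))
    <= a%:R * b%:R / m%:R ^+ 2.
Proof.
move=> m0 a0 b0.
have rhs0 : 0 <= a%:R * b%:R / m%:R ^+ 2 :> R by rewrite divr_ge0 ?mulr_ge0 ?exprn_ge0.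
have [->|w0] := posnP w; first by rewrite keep_prob0 !(mul0r, mulr0).
have p0 := @keep_prob_gt0 w a b m0 w0 a0.
have [p1|p1] := eqVneq (keep_prob w a b) 1; first by rewrite p1 subrr !mulr0.
move: p1 p0; rewrite /keep_prob.
case: (leP 1 (m%:R * _ * _)) => [_|lt1 _ p0]; first by rewrite eqxx.
move: lt1 p0; set x : R := w%:R; set A : R := a%:R; set B : R := b%:R; set M : R := m%:R.
have [x0 A0 B0 M0] : [/\ 0 < x, 0 < A, 0 < B & 0 < M] by rewrite !ltr0n.
have AB0 : 0 < A + B by rewrite addr_gt0.
have -> : M * x * (A^-1 + B^-1) = x * (M * (A + B) / (A * B)).
  by field; rewrite !gt_eqF.
set t := M * (A + B) / (A * B) => lt1 p0.
have t0 : 0 < t by rewrite /t divr_gt0 ?mulr_gt0.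
have -> : (x / (x * t)) ^+ 2 * (x * t * (1 - x * t)) = x * t * (1 - x * t) / t ^+ 2.
  by field; rewrite !gt_eqF.
have le1 : x * t * (1 - x * t) <= 1 by nra.
apply: (@le_trans _ _ (t ^+ 2)^-1).
  by rewrite ler_pdivrMr ?exprn_gt0 // mulVf // gt_eqF ?exprn_gt0.
have -> : (t ^+ 2)^-1 = (A * B) ^+ 2 / (M * (A + B)) ^+ 2.
  by rewrite /t; field; rewrite !gt_eqF.
rewrite ler_pdivrMr; last first.
  by rewrite exprn_gt0 // mulr_gt0.
have -> : A * B / M ^+ 2 * (M * (A + B)) ^+ 2 = A * B * (A + B) ^+ 2.
  by field; rewrite gt_eqF.
by rewrite expr2 ler_wpM2l ?mulr_ge0 ?ltW //; nra.
Qed.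

(* The expansion bound controls the volume of the lighter side only, so every
   cluster is estimated from that side. *)
Definition light_side d c S z :=
  (\sum_(u in S | c u == z) d u <= \sum_(u in ~: S | c u == z) d u)%N.

Definition light d c S u := (u \in S) == light_side d c S (c u).

(** Volume minus inner weight, the latter by inverse-probability weighting. A kept edge has [e u v]
    equal to its true weight, so the rate is the one used in sampling; a dropped edge contributes
    0. *)
Definition cluster_estimate d c e S : R :=
  \sum_(u | light d c S u)
    ((d u)%:R - \sum_(v | light d c S v) (e u v)%:R / keep_prob (e u v) (d u) (d v)).

(** The two ends of an edge share a cluster, hence a choice of side. Clusters estimated from the
    complement of [S] list their cut edges in reverse orientation, which symmetry undoes. *)
Lemma light_cut d g c S :
  (forall u v, g u v = g v u) -> (forall u v, (0 < g u v)%N -> c u = c v) ->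
  (\sum_(u | light d c S u) \sum_(v | ~~ light d c S v) g u v =
   \sum_(u in S) \sum_(v in ~: S) g u v)%N.
Proof.
move=> gC gc; pose s u := light_side d c S (c u).
have E1 : (\sum_(u | light d c S u) \sum_(v | ~~ light d c S v) g u v =
  \sum_u \sum_v ([&& u \in S, v \notin S & s u] * g u v +
                 [&& v \in S, u \notin S & ~~ s v] * g v u))%N.
  rewrite big_mkcond; apply: eq_bigr => u _.
  transitivity (\sum_v (light d c S u && ~~ light d c S v) * g u v)%N.
    case: (light d c S u); last by rewrite big1.
    by rewrite big_mkcond; apply: eq_bigr => v _; case: light; rewrite ?mul1n.
  apply: eq_bigr => v _; rewrite [g v u]gC /light -/(s u) -/(s v).
  case: (posnP (g u v)) => [->|/gc cuv]; first by rewrite !muln0.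
  have -> : s v = s u by rewrite /s cuv.
  by case: (u \in S); case: (v \in S); case: (s u); rewrite /= ?mul1n ?mul0n ?addn0.
rewrite E1; under eq_bigr do rewrite big_split /=.
rewrite big_split /= [X in (_ + X)%N]exchange_big -big_split /=.
rewrite [RHS]big_mkcond; apply: eq_bigr => u _; rewrite -big_split /=.
transitivity (\sum_v ((u \in S) && (v \notin S)) * g u v)%N.
  by apply: eq_bigr => v _; case: (u \in S); case: (v \in S); case: (s u) => //=;
    rewrite ?mul1n ?mul0n ?addn0.
case: (u \in S); last by rewrite big1.
rewrite [RHS]big_mkcond; apply: eq_bigr => v _; rewrite inE.
by case: (v \in S); rewrite ?mul1n.
Qed.

(** The degree of a light vertex splits into its cut part and its inner part. The cut part cancels
    exactly, and the inner part leaves centred indicators. *)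
Lemma cluster_estimate_error g c S (w : V -> V -> bool)
  (p := fun u v => keep_prob (g u v) (degree g u) (degree g v)) :
  (0 < m)%N ->
  (forall u v, g u v = g v u) -> (forall u v, (0 < g u v)%N -> c u = c v) ->
  cluster_estimate (degree g) c (fun u v => w u v * g u v)%N S
    - (\sum_(u in S) \sum_(v in ~: S) g u v)%:R =
  \sum_u \sum_v - (light (degree g) c S u && light (degree g) c S v)%:R
                * ((g u v)%:R / p u v) * ((w u v)%:R - p u v).
Proof.
move=> m0 gC gc; rewrite -(light_cut (degree g) S gC gc) /cluster_estimate.
rewrite natr_sum -sumrB big_mkcond; apply: eq_bigr => u _.
case: ifP => [lu|lu]; last by rewrite big1 // => v _; rewrite oppr0 !mul0r.
have dE : (degree g u)%:R = \sum_(v | light (degree g) c S v) (g u v)%:R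
                          + \sum_(v | ~~ light (degree g) c S v) (g u v)%:R :> R.
  by rewrite /degree natr_sum (bigID (light (degree g) c S)).
rewrite natr_sum dE addrAC addrK -sumrB big_mkcond; apply: eq_bigr => v _.
case: ifP => lv; last by rewrite oppr0 !mul0r.
have [g0|g0] := posnP (g u v).
  by rewrite /p g0 muln0 keep_prob0 !mul0r mulr0 mul0r subrr.
have du : (0 < degree g u)%N by rewrite /degree (bigD1 v) //= ltn_addr.
have p0 := keep_prob_gt0 (degree g v) m0 g0 du.
rewrite mulN1r /p; case: (w u v); rewrite /= ?mul1n ?mul0n ?keep_prob0.
  by field; rewrite gt_eqF.
by rewrite mul0r subr0; field; rewrite gt_eqF.
Qed.

(** The bounds [d u * d v / m ^ 2] add up to [vol z ^ 2 / m ^ 2] on each cluster. Expansion gives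
    [vol z <= q * cut z], and a sum of squares is at most the square of the sum. *)
Lemma cluster_estimate_variance q g c S
  (p := fun u v => keep_prob (g u v) (degree g u) (degree g v)) :
  (0 < m)%N -> (forall u v, g u v = g v u) ->
  (forall u v, (0 < g u v)%N -> c u = c v) -> is_expander q g c ->
  \sum_u \sum_v (- (light (degree g) c S u && light (degree g) c S v)%:R
                * ((g u v)%:R / p u v)) ^+ 2 * (p u v * (1 - p u v))
  <= (q%:R / m%:R) ^+ 2 * (\sum_(u in S) \sum_(v in ~: S) g u v)%:R ^+ 2.
Proof.
move=> m0 gC gc exp; set l := light (degree g) c S; set d := degree g.
have dgt0 u v : (0 < g u v)%N -> (0 < d u)%N.
  by move=> guv; rewrite /d /degree (bigD1 v) //= ltn_addr.
have M0 : 0 < m%:R :> R by rewrite ltr0n.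
pose vol z := (\sum_(u | l u && (c u == z)) d u)%N.
pose cut z := cluster_cut g c z S.
have vol_cut z : (vol z <= q * cut z)%N.
  apply: leq_trans (exp z S).
  have -> : vol z = if light_side d c S z then cluster_vol g c z S
                    else cluster_vol g c z (~: S).
    rewrite /vol /cluster_vol; case: ifP => H; apply: eq_bigl => u; rewrite ?inE /l /light;
      by have [->|] := eqVneq (c u) z; rewrite ?andbF // H; case: (u \in S).
  rewrite /light_side -/(cluster_vol g c z S) -/(cluster_vol g c z (~: S)).
  by case: ifP; lia.
have cutE : (\sum_(u in S) \sum_(v in ~: S) g u v = \sum_z cut z)%N.
  exact: (partition_big c xpredT).
apply: (@le_trans _ _ (m%:R ^- 2 * (\sum_z vol z ^ 2)%:R)).
  rewrite -[leLHS]mulr1.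
  have -> : (\sum_z vol z ^ 2 =
             \sum_u \sum_v (l u && l v && (c u == c v)) * (d u * d v))%N.
    transitivity (\sum_z \sum_u \sum_v
       ((l u && (c u == z)) * d u) * ((l v && (c v == z)) * d v))%N.
      apply: eq_bigr => z _; rewrite -mulnn {1}/vol big_mkcond big_distrl.
      apply: eq_bigr => u _; rewrite /vol big_mkcond big_distrr /=.
      by apply: eq_bigr => v _; do 2!case: ifP => _; rewrite ?mul1n ?mul0n ?muln0.
    rewrite exchange_big; apply: eq_bigr => u _.
    rewrite exchange_big; apply: eq_bigr => v _.
    rewrite (bigD1 (c u)) //= big1 ?addn0; last first.
      by move=> z /negbTE; rewrite [z == _]eq_sym => ->; rewrite andbF.
    rewrite eqxx andbT [c v == _]eq_sym.
    by case: (l u); case: (l v); case: (_ == _); rewrite /= ?mul1n ?mul0n ?muln0.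
  rewrite mulr1 natr_sum mulr_sumr; apply: ler_sum => u _.
  rewrite natr_sum mulr_sumr; apply: ler_sum => v _.
  rewrite -/l; case: (l u && l v); last first.
    by rewrite oppr0 mul0r expr0n mul0r /= mulr0.
  have [g0|g0] := posnP (g u v).
    by rewrite /p g0 !(mul0r, mulr0) expr0n mul0r mulr_ge0 ?invr_ge0 ?exprn_ge0.
  rewrite (gc _ _ g0) eqxx mul1n mulN1r sqrrN.
  apply: le_trans (keep_prob_variance _ m0 _ _) _; first exact: dgt0 g0.
    by apply: (dgt0 v u); rewrite gC.
  by rewrite natrM mulrC.
have -> : (q%:R / m%:R) ^+ 2 = m%:R ^- 2 * q%:R ^+ 2 :> R by field; rewrite gt_eqF.
rewrite -mulrA ler_wpM2l ?invr_ge0 ?exprn_ge0 // -natrX -natrX -natrM ler_nat.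
rewrite cutE; apply: (@leq_trans (\sum_z (q * cut z) ^ 2)).
  by apply: leq_sum => z _; rewrite leq_exp2r.
under eq_bigr do rewrite expnMn; rewrite -big_distrr /= leq_mul2l; apply/orP; right.
rewrite -mulnn big_distrl; apply: leq_sum => z _ /=.
by rewrite -mulnn leq_mul2l (bigD1 z) //= leq_addr orbT.
Qed.
End ClusterEstimate.

(** For each non-isolated [u] the ratios [g u v / d u] sum to 1, and the rate contains one such
    ratio for either end. *)
Lemma keep_prob_sum (R : realType) (V : finType) (m : nat) (g : V -> V -> nat) :
  (forall u v, g u v = g v u) ->
  \sum_u \sum_v keep_prob R m (g u v) (degree g u) (degree g v)
    <= (2 * m * #|[set u | degree g u != 0%N]|)%:R.
Proof.
move=> gC; set d := degree g.
have half : \sum_u \sum_v (g u v)%:R / (d u)%:R = #|[set u | d u != 0%N]|%:R :> R.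
  rewrite -sum1_card natr_sum [RHS]big_mkcond; apply: eq_bigr => u _.
  rewrite -mulr_suml -natr_sum inE; have [du0|du0] := eqVneq (d u) 0%N.
    by rewrite du0 invr0 mulr0.
  by rewrite mulfV // pnatr_eq0.
apply: (@le_trans _ _ (\sum_u \sum_v
    (m%:R * ((g u v)%:R / (d u)%:R) + m%:R * ((g v u)%:R / (d v)%:R)))).
  apply: ler_sum => u _; apply: ler_sum => v _.
  by rewrite /keep_prob ge_min [g v u]gC mulrDr !mulrA lexx orbT.
under eq_bigr do rewrite big_split /=.
rewrite big_split /= [X in _ + X]exchange_big /=.
under eq_bigr do rewrite -mulr_sumr.
rewrite -mulr_sumr half -mulrDl -natrD -natrM ler_nat; lia.
Qed.

(** * Joint sampling over all scales and levels *)

Section SampledFamily.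
Variables (R : realType) (V : finType) (J L m : nat).
Variables (g : 'I_J -> 'I_L -> V -> V -> nat) (c : 'I_J -> 'I_L -> V -> V).
Hypothesis gC : forall j k u v, g j k u v = g j k v u.
Hypothesis gc : forall j k u v, (0 < g j k u v)%N -> c j k u = c j k v.

Definition sampling_prob (i : 'I_J * 'I_L * V * V) : R :=
  let: (j, k, u, v) := i in
  keep_prob R m (g j k u v) (degree (g j k) u) (degree (g j k) v).

Lemma sampling_prob01 i : 0 <= sampling_prob i <= 1.
Proof. by case: i => [[[j k] u] v]; rewrite keep_prob_ge0 keep_prob_le1. Qed.

Lemma sum_quad (F : 'I_J * 'I_L * V * V -> R) :
  \sum_i F i = \sum_j \sum_k \sum_u \sum_v F (j, k, u, v).
Proof. by rewrite !pair_bigA; apply: eq_bigr => -[[[j k] u] v]. Qed.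

Lemma sum_sampling_prob :
  \sum_i sampling_prob i
  <= (2 * m * \sum_j \sum_k #|[set u | degree (g j k) u != 0%N]|)%:R.
Proof.
rewrite sum_quad big_distrr natr_sum; apply: ler_sum => j _.
rewrite big_distrr natr_sum; apply: ler_sum => k _.
exact: keep_prob_sum.
Qed.

Definition sampled_weight (w : {ffun 'I_J * 'I_L * V * V -> bool}) j k u v :=
  (w (j, k, u, v) * g j k u v)%N.

(** Chebyshev's inequality at one scale: variances add over the levels to at most
    [(q / m) ^ 2 * cut ^ 2], and [3 * q <= eps * m] makes this one ninth of [(eps * cut) ^ 2]. *)
Lemma sampled_estimate_concentration q j (S : {set V}) (eps : R)
  (cut := (\sum_k \sum_(u in S) \sum_(v in ~: S) g j k u v)%N) :
  (0 < m)%N -> (forall k, is_expander q (g j k) (c j k)) ->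
  0 < eps -> 3 * q%:R <= eps * m%:R ->
  (0 < cut)%N ->
  prob (bernoulli_dist sampling_prob01) (fun w => eps * cut%:R <
    `| \sum_k cluster_estimate R m (degree (g j k)) (c j k) (sampled_weight w j k) S
       - cut%:R |) <= 1 / 9.
Proof.
move=> m0 exp eps0 qm cut0.
pose a (i : 'I_J * 'I_L * V * V) : R := let: (j', k, u, v) := i in
  if j' == j then
    - (light (degree (g j k)) (c j k) S u && light (degree (g j k)) (c j k) S v)%:R
      * ((g j k u v)%:R / sampling_prob (j, k, u, v))
  else 0.
pose Y (w : {ffun 'I_J * 'I_L * V * V -> bool}) :=
  \sum_i a i * ((w i)%:R - sampling_prob i).
have YE w : \sum_k cluster_estimate R m (degree (g j k)) (c j k) (sampled_weight w j k) S
    - cut%:R = Y w.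
  rewrite /Y sum_quad (bigD1 j) //= [X in _ = _ + X]big1 ?addr0; last first.
    move=> j' /negbTE j'j; apply: big1 => k _; apply: big1 => u _.
    by apply: big1 => v _; rewrite j'j mul0r.
  rewrite natr_sum -sumrB; apply: eq_bigr => k _.
  rewrite (@cluster_estimate_error _ _ _ _ _ _ (fun u v => w (j, k, u, v))
             m0 (@gC j k) (@gc j k)).
  by apply: eq_bigr => u _; apply: eq_bigr => v _; rewrite eqxx.
have varY : \sum_i a i ^+ 2 * (sampling_prob i * (1 - sampling_prob i))
    <= (q%:R / m%:R) ^+ 2 * cut%:R ^+ 2.
  rewrite sum_quad (bigD1 j) //= [X in _ + X]big1 ?addr0; last first.
    move=> j' /negbTE j'j; apply: big1 => k _; apply: big1 => u _.
    by apply: big1 => v _; rewrite j'j expr0n mul0r.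
  pose cutk k := (\sum_(u in S) \sum_(v in ~: S) g j k u v)%N.
  apply: (@le_trans _ _ (\sum_k (q%:R / m%:R) ^+ 2 * (cutk k)%:R ^+ 2)).
    apply: ler_sum => k _; rewrite eqxx.
    exact: (cluster_estimate_variance _ S m0 (@gC j k) (@gc j k) (exp k)).
  rewrite -mulr_sumr ler_wpM2l ?sqr_ge0 // -natrX.
  under eq_bigr do rewrite -natrX.
  rewrite -natr_sum ler_nat -mulnn {1}/cut big_distrl; apply: leq_sum => k _ /=.
  by rewrite -mulnn leq_mul2l /cut (bigD1 k) //= leq_addr orbT.
have t0 : 0 < (eps * cut%:R) ^+ 2 by rewrite exprn_gt0 // mulr_gt0 // ltr0n.
apply: (@le_trans _ _ (prob (bernoulli_dist sampling_prob01)
                        (fun w => (eps * cut%:R) ^+ 2 <= Y w ^+ 2))).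
  apply: prob_le => w; rewrite YE => /ltW H.
  rewrite -[leRHS]real_normK ?num_real // ler_sqr ?nnegrE //.
  by rewrite mulr_ge0 // ltW.
apply: le_trans (markov_ineq _ _ t0) _; first by move=> w; apply: sqr_ge0.
rewrite expect_bernoulli_sqr ler_pdivrMr //; apply: le_trans varY _.
rewrite [(eps * _) ^+ 2]exprMn [leRHS]mulrA ler_wpM2r ?sqr_ge0 //.
have M0 : 0 < m%:R :> R by rewrite ltr0n.
rewrite expr_div_n ler_pdivrMr ?exprn_gt0 //.
have : (3 * q%:R) ^+ 2 <= (eps * m%:R) ^+ 2 :> R.
  by rewrite ler_sqr ?nnegrE ?mulr_ge0 // ltW.
rewrite !exprMn; lra.
Qed.

End SampledFamily.

(** * Scales and contracted graphs *)

Section CutWeight.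
Variables (R : realType) (V : finType) (G : wgraph R V).

Definition pair_weight (u v : V) : R :=
  if [set u; v] \in edges G then weight G [set u; v] else 0.

Lemma pair_weightC u v : pair_weight u v = pair_weight v u.
Proof. by rewrite /pair_weight finset.setUC. Qed.

Lemma pair_weight_ge0 u v : 0 <= pair_weight u v.
Proof. by rewrite /pair_weight; case: ifP => // /weight_ge0. Qed.

Lemma pair_weight_range W u v : weights_in_range W G -> 0 < pair_weight u v ->
  1 <= pair_weight u v <= W.
Proof.
rewrite /pair_weight => GW; case: ifP => [/GW H /lt0r_neq0 /H //|_]; by rewrite ltxx.
Qed.

(** An edge comes from two ordered pairs, of which exactly one leads from [S] to its complement when
    the edge is cut, and none otherwise. *)
Lemma cut_weightE (S : {set V}) :
  cut_weight G S = \sum_(u in S) \sum_(v in ~: S) pair_weight u v.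
Proof.
transitivity (\sum_(e in edges G) \sum_(u in S) \sum_(v in ~: S)
                if e == [set u; v] then weight G e else 0); last first.
  rewrite exchange_big; apply: eq_bigr => u _.
  rewrite exchange_big; apply: eq_bigr => v _.
  rewrite /pair_weight -big_mkcondr; case: ifP => uvG.
    rewrite (big_pred1 [set u; v]) // => e /=.
    by have [->|] := eqVneq e [set u; v]; rewrite ?uvG ?andbF.
  rewrite big_pred0 // => e; have [->|] := eqVneq e [set u; v]; by rewrite ?uvG ?andbF.
rewrite /cut_weight big_mkcondr; apply: eq_bigr => e /(edges_card2 (w:=G)) /eqP.
case/cards2P => x [y [xy ->]].
have eq2 u v : ([set x; y] == [set u; v]) = (u == x) && (v == y) || (u == y) && (v == x).
  apply/eqP/orP => [E|[]/andP[/eqP-> /eqP->] //]; last by rewrite finset.setUC.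
  have xuv : x \in [set u; v] by rewrite -E set21.
  have yuv : y \in [set u; v] by rewrite -E set22.
  move: xuv yuv; rewrite !inE ![x == _]eq_sym ![y == _]eq_sym.
  move=> /orP[]/eqP ex /orP[]/eqP ey; rewrite -?ex -?ey ?eqxx; auto.
    by move: xy; rewrite -ex ey eqxx.
  by move: xy; rewrite -ex ey eqxx.
pose ind (a b : V) : bool := (a \in S) && (b \notin S).
transitivity (\sum_u \sum_v ((ind x y && ((u == x) && (v == y)))%:R
                + (ind y x && ((u == y) && (v == x)))%:R) * weight G [set x; y]).
  have one a b : \sum_u \sum_v (ind a b && ((u == a) && (v == b)))%:R * weight G [set x; y]
      = (ind a b)%:R * weight G [set x; y].
    rewrite (bigD1 a) //= [X in _ + X]big1 ?addr0; last first.
      by move=> u /negbTE ->; apply: big1 => v _; rewrite andbF mul0r.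
    rewrite (bigD1 b) //= [X in _ + X]big1 ?addr0 ?eqxx ?andbT //.
    by move=> v /negbTE ->; rewrite !andbF mul0r.
  under eq_bigr do under eq_bigr do rewrite mulrDl.
  under eq_bigr do rewrite big_split /=.
  rewrite big_split /= !one /ind.
  have -> : #|[set x; y] :&: S| = ((x \in S) + (y \in S))%N.
    rewrite -sum1_card (eq_bigl (fun z => (z \in [set x; y]) && (z \in S))); last first.
      by move=> z; rewrite finset.in_setI.
    rewrite big_mkcondr big_setU1 ?inE //= big_set1.
    by case: (x \in S); case: (y \in S).
  by case: (x \in S); case: (y \in S); rewrite /= ?mul0r ?mul1r ?addr0 ?add0r.
rewrite [RHS]big_mkcond; apply: eq_bigr => u _.
transitivity (\sum_v if ind u v && ([set x; y] == [set u; v])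
                     then weight G [set x; y] else 0).
  apply: eq_bigr => v _; rewrite eq2 /ind.
  have yx : (y == x) = false by rewrite eq_sym (negbTE xy).
  have [->|ux] := eqVneq u x; have [->|vy] := eqVneq v y; rewrite ?(negbTE xy) ?yx /=
    ?andbF ?andbT ?mul0r ?addr0 ?add0r ?mul0r //; last 1 first.
    have [->|uy] := eqVneq u y; have [->|vx] := eqVneq v x; rewrite ?andbF ?andbT ?mul0r //.
    by case: ifP; rewrite ?mul1r ?mul0r.
  - by case: ifP; rewrite ?mul1r ?mul0r.
rewrite /ind; case: (u \in S); last by rewrite big1.
by rewrite [RHS]big_mkcond; apply: eq_bigr => v _; rewrite inE; case: (v \in S).
Qed.
End CutWeight.

Section Hierarchy.
Variables (R : realType) (V : finType) (wt : V -> V -> R) (B W : R).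
Hypothesis wtC : forall u v, wt u v = wt v u.
Hypothesis wt_ge0 : forall u v, 0 <= wt u v.
Hypothesis wt_range : forall u v, 0 < wt u v -> 1 <= wt u v <= W.
Hypothesis B1 : 1 <= B.

Let B0 : 0 < B. Proof. exact: lt_le_trans B1. Qed.

Definition linked j : rel V := fun u v => B ^+ j <= wt u v.

Lemma linked_connectC j u v : connect (linked j) u v = connect (linked j) v u.
Proof. by apply: sym_connect_sym => {}u {}v; rewrite /linked wtC. Qed.

Lemma linked_le i j u v : (i <= j)%N ->
  connect (linked j) u v -> connect (linked i) u v.
Proof.
move=> ij; apply: connect_sub => {}u {}v H; apply: connect1.
by apply: le_trans H; rewrite ler_weXn2l.
Qed.

(** Taking the vertex of least rank makes representatives coherent: one that represents a coarse
    component also represents the finer component around it at every higher scale. *)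
Definition rep j v : V := arg_min v (connect (linked j) v) (fun u => enum_rank u : nat).

Lemma rep_connect j v : connect (linked j) v (rep j v).
Proof. by rewrite /rep; case: arg_minnP. Qed.

Lemma rep_min j v u : connect (linked j) v u -> (enum_rank (rep j v) <= enum_rank u)%N.
Proof. by rewrite /rep; case: arg_minnP => // x _; apply. Qed.

Lemma rep_eq j u v : connect (linked j) u v -> rep j u = rep j v.
Proof.
move=> uv; apply/enum_rank_inj/val_inj/eqP; rewrite eqn_leq; apply/andP; split.
  by apply: rep_min; apply: connect_trans uv (rep_connect j v).
by apply: rep_min; apply: connect_trans (rep_connect j u); rewrite linked_connectC.
Qed.

Lemma rep_rep i j v : (i <= j)%N -> rep i (rep j v) = rep i v.
Proof. by move=> ij; apply/esym/rep_eq/(linked_le ij)/rep_connect. Qed.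

Lemma rep_fixed_le i j v : (i <= j)%N -> rep i v = v -> rep j v = v.
Proof.
move=> ij iv; apply/enum_rank_inj/val_inj/eqP; rewrite eqn_leq; apply/andP; split.
  exact: rep_min.
by rewrite -{1}iv; apply/rep_min/(linked_le ij)/rep_connect.
Qed.

(** Passing down from scale [j.+1] to [j], [v] stops being a representative. This happens at most
    once per vertex, so all merges together need at most [#|V|] records. *)
Definition merges j v := (rep j.+1 v == v) && (rep j v != v).

Lemma merges_inj i j v : merges i v -> merges j v -> i = j.
Proof.
have no k l : merges k v -> merges l v -> (k < l)%N -> False.
  by move=> /andP[/eqP kv _] /andP[_ /eqP lv] /rep_fixed_le/(_ kv).
by move=> iv jv; case: (ltngtP i j) => // ij; [case: (no _ _ iv jv)|case: (no _ _ jv iv)].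
Qed.

(** Descending induction on the scale: no edge reaches [B ^ J], so the components there are single
    vertices, and each later merge joins vertices on the same side of [S]. *)
Lemma rep_respected J (S : {set V}) j : W < B ^+ J -> (j <= J)%N ->
  (forall i v, (j <= i < J)%N -> merges i v -> (v \in S) = (rep i v \in S)) ->
  forall v, (rep j v \in S) = (v \in S).
Proof.
move=> WJ jJ; rewrite -(subKn jJ); move: (J - j)%N (leq_subr j J) => n.
elim: n => [|n IH] nJ H v.
  rewrite subn0; have := rep_connect J v; set y := rep J v.
  case/connectP => -[|z p] /=; first by move=> _ ->.
  case/andP => vz; have : 0 < wt v z by apply: lt_le_trans vz; rewrite exprn_gt0.
  by case/wt_range/andP => _ /(le_trans vz); rewrite leNgt WJ.
have IHv : (rep (J - n) v \in S) = (v \in S).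
  by apply: IH => [|i x /andP[Hi iJ]]; [lia | apply: H; lia].
have E : (J - n)%N = (J - n.+1).+1 by lia.
rewrite -IHv -(@rep_rep (J - n.+1) (J - n)); last by lia.
set x := rep (J - n) v; have [-> //|mx] := eqVneq (rep (J - n.+1) x) x.
rewrite -H //; first by lia.
by rewrite /merges mx -E /x rep_rep // eqxx.
Qed.

(** A path of links joins [v] to its representative, and some link on it must cross [S]. A separated
    merge thus certifies a heavy cut edge. *)
Lemma merge_separated j v (S : {set V}) : (v \in S) != (rep j v \in S) ->
  exists2 u, u \in S & exists2 x, x \in ~: S & B ^+ j <= wt u x.
Proof.
move=> sep.
case: (boolP [exists u in S, exists x in ~: S, B ^+ j <= wt u x]).
  by case/exists_inP => u uS /exists_inP[x xS ux]; exists u => //; exists x.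
move=> /exists_inPn none; move/eqP: sep; case.
apply: closed_connect (rep_connect j v) => u x ux.
have crossing a b : linked j a b -> ~~ ((a \in S) && (b \notin S)).
  move=> ab; apply/negP => /andP[aS bS]; have /exists_inP[] := none a aS.
  by exists b; rewrite ?inE.
have := crossing u x ux; have := crossing x u.
rewrite /linked wtC => /(_ ux).
by case: (u \in S); case: (x \in S).
Qed.

Lemma sum_card_merges J : (\sum_(j < J) #|[set v | merges j v]| <= #|V|)%N.
Proof.
under eq_bigr do rewrite -sum1_card big_mkcond.
rewrite exchange_big -sum1_card; apply: leq_sum => v _.
have [/existsP[j jv]|/existsPn none] := boolP [exists j : 'I_J, merges j v].
  rewrite (bigD1 j) //= big1 ?addn0; first by rewrite inE jv.
  move=> i /eqP ij; rewrite inE; case: ifP => // iv.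
  by case: ij; apply/val_inj/(merges_inj iv jv).
by rewrite big1 // => j _; rewrite inE (negbTE (none j)).
Qed.

(** A quotient rather than a power of [j.-1], so that the unit at [j = 0] is [1 / B] and not 1. *)
Definition scale_unit j := B ^+ j / B.

Lemma scale_unit_gt0 j : 0 < scale_unit j.
Proof. by rewrite divr_gt0 ?exprn_gt0. Qed.

Definition rounded j u v := Num.truncn (wt u v / scale_unit j).

(* Rounded graph of scale [B ^+ j] after contracting all edges of weight at
   least [B ^+ j.+1]; each component is represented by its [rep]. *)
Definition contracted j x y : nat :=
  if x == y then 0%N
  else (\sum_(u | rep j.+1 u == x) \sum_(v | rep j.+1 v == y) rounded j u v)%N.

Lemma contractedC j x y : contracted j x y = contracted j y x.
Proof.
rewrite /contracted eq_sym; case: eqP => // _; rewrite exchange_big.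
by apply: eq_bigr => u _; apply: eq_bigr => v _; rewrite /rounded wtC.
Qed.

Lemma contracted_cut j (S : {set V}) :
  (forall v, (rep j.+1 v \in S) = (v \in S)) ->
  (\sum_(x in S) \sum_(y in ~: S) contracted j x y =
   \sum_(u in S) \sum_(v in ~: S) rounded j u v)%N.
Proof.
move=> HS; rewrite [RHS](partition_big (rep j.+1) (fun x => x \in S)) /=; last first.
  by move=> u; rewrite HS.
apply: eq_bigr => x xS.
transitivity (\sum_(y in ~: S) \sum_(u | rep j.+1 u == x)
                \sum_(v | rep j.+1 v == y) rounded j u v)%N.
  apply: eq_bigr => y yS; rewrite /contracted; case: eqP => // xy.
  by move: yS; rewrite -xy inE xS.
rewrite exchange_big; apply: eq_big => [u|u ux].
  by case: eqP => [ux|]; rewrite ?andbF // -HS ux xS.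
rewrite [RHS](partition_big (rep j.+1) (fun y => y \in ~: S)) /=; last first.
  by move=> v; rewrite !inE HS.
apply: eq_bigr => y yS; apply: eq_bigl => v.
by case: eqP => [vy|]; rewrite ?andbF // inE -HS vy -finset.in_setC yS.
Qed.

(** Vertices in different components of scale [j.+1] are joined by weight below [B ^ j.+1], which is
    [B ^ 2] units. *)
Lemma rounded_bound j (b : nat) u v : B ^+ 2 <= b%:R -> rep j.+1 u != rep j.+1 v ->
  (rounded j u v <= b)%N.
Proof.
move=> Bb uv; rewrite -ltnS /rounded truncn_lt_nat; last first.
  by rewrite divr_ge0 // ltW ?scale_unit_gt0.
have : wt u v < B ^+ j.+1.
  by rewrite ltNge; apply: contra uv => uv; apply/eqP/rep_eq; apply: connect1.
move=> lt; rewrite ltr_pdivrMr ?scale_unit_gt0 //; apply: (lt_le_trans lt).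
have -> : B ^+ j.+1 = B ^+ 2 * scale_unit j.
  by rewrite /scale_unit exprS; field; rewrite gt_eqF.
apply: ler_wpM2r; first by rewrite ltW ?scale_unit_gt0.
by apply: (le_trans Bb); rewrite ler_nat.
Qed.

Lemma contracted_total j (b : nat) : B ^+ 2 <= b%:R ->
  (total_weight (contracted j) <= #|V| ^ 2 * b)%N.
Proof.
move=> Bb.
have -> : (#|V| ^ 2 * b = \sum_(u : V) \sum_(v : V) b)%N.
  by rewrite !sum_nat_const mulnA mulnn.
rewrite (partition_big (rep j.+1) xpredT) //=; apply: leq_sum => x _.
under eq_bigr do rewrite (partition_big (rep j.+1) xpredT) //=.
rewrite exchange_big; apply: leq_sum => y _; rewrite /contracted; case: eqP => // xy.
apply: leq_sum => u /eqP ux; apply: leq_sum => v /eqP vy.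
by apply: rounded_bound; rewrite // ux vy; apply/eqP.
Qed.

Lemma contracted_active j x : degree (contracted j) x != 0%N ->
  rep j.+1 x = x /\ exists y, [/\ rep j.+1 y = y, y != x & connect (linked j.-1) x y].
Proof.
rewrite /degree sum_nat_eq0 => /forallPn[y]; rewrite /= /contracted.
case: (eqVneq x y) => //= xy; rewrite sum_nat_eq0 => /forallPn[u].
rewrite negb_imply => /andP[/eqP ux]; rewrite sum_nat_eq0 => /forallPn[v].
rewrite negb_imply => /andP[/eqP vy].
rewrite -lt0n /rounded truncn_gt0 ler_pdivlMr ?scale_unit_gt0 // mul1r => uv.
split; first by rewrite -ux rep_rep.
exists y; split; [by rewrite -vy rep_rep | by rewrite eq_sym |].
have jj : (j.-1 <= j.+1)%N by lia.
apply: (@connect_trans _ _ u).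
  by rewrite linked_connectC -ux; apply: (linked_le jj); apply: rep_connect.
apply: (@connect_trans _ _ v); last first.
  by rewrite -vy; apply: (linked_le jj); apply: rep_connect.
(* At [j = 0] the predecessor is again 0, and the link holds because nonzero weights are at least
   1. *)
apply: connect1; rewrite /linked; case: j {ux vy jj} uv => [|j] uv /=.
  by have /wt_range/andP[] : 0 < wt u v by apply: lt_le_trans uv; apply: scale_unit_gt0.
by apply: le_trans uv; rewrite /scale_unit exprS mulrC mulKf ?gt_eqF.
Qed.

(** An active vertex loses its role between scales [j.+1] and [j.-1], or else it represents a
    component of scale [j.-1] containing a vertex that does. Each vertex losing its role merges at
    [j] or at [j.-1]. *)
Lemma card_active j :
  (#|[set x | degree (contracted j) x != 0%N]| <=
   2 * (#|[set v | merges j v]| + #|[set v | merges j.-1 v]|))%N.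
Proof.
pose D := [set v | (rep j.+1 v == v) && (rep j.-1 v != v)].
apply: (@leq_trans (2 * #|D|)); last first.
  rewrite leq_mul2l /=; apply: leq_trans (leq_card_setU _ _).
  apply: subset_leq_card; apply/fintype.subsetP => v; rewrite !inE /merges => /andP[jv].
  have [jv'|] := eqVneq (rep j v) v; rewrite ?jv //= => j'v.
  move: jv' j'v; clear; case: j => [->|j jv' j'v]; first by rewrite eqxx.
  by rewrite /= jv' j'v eqxx.
apply: (@leq_trans #|D :|: (rep j.-1 @: D)|); last first.
  apply: leq_trans (leq_card_setU _ _) _.
  by rewrite mul2n -addnn leq_add2l leq_imset_card.
apply: subset_leq_card; apply/fintype.subsetP => x.
rewrite inE => /contracted_active[jx [y [jy yx xy]]]; rewrite inE.
have [x0|x0] := eqVneq (rep j.-1 x) x; last by rewrite inE jx eqxx x0.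
apply/orP; right; apply/imsetP; exists y; last by rewrite -(rep_eq xy).
by rewrite inE jy eqxx /= -(rep_eq xy) x0 eq_sym.
Qed.

Lemma sum_card_active J :
  (\sum_(j < J) #|[set x | degree (contracted j) x != 0%N]| <= 6 * #|V|)%N.
Proof.
apply: (@leq_trans (\sum_(j < J) 2 * (#|[set v | merges j v]| + #|[set v | merges j.-1 v]|))).
  by apply: leq_sum => j _; apply: card_active.
rewrite -big_distrr /= big_split /=.
have H1 := sum_card_merges J.
(* Since [0.-1 = 0], the merges of scale 0 occur twice, hence the factor 2. *)
have : (\sum_(j < J) #|[set v | merges j.-1 v]| <= 2 * #|V|)%N.
  case: J {H1} => [|J]; first by rewrite big_ord0.
  rewrite big_ord_recl /= mul2n -addnn leq_add ?max_card //.
  exact: sum_card_merges.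
by move=> H2; apply: leq_trans (leq_mul (leqnn 2) (leq_add H1 H2)) _; rewrite -mulSn mulnA.
Qed.

(** Rounding down loses at most one unit per crossing pair, and there are at most [#|V| ^ 2]
    pairs. *)
Lemma rounded_cut_bounds j (S : {set V})
  (r := (\sum_(u in S) \sum_(v in ~: S) rounded j u v)%N)
  (cut := \sum_(u in S) \sum_(v in ~: S) wt u v) :
  scale_unit j * r%:R <= cut <= scale_unit j * r%:R + scale_unit j * (#|V| ^ 2)%:R.
Proof.
have U0 := scale_unit_gt0 j.
have bnd u v : scale_unit j * (rounded j u v)%:R <= wt u v
               <= scale_unit j * (rounded j u v)%:R + scale_unit j.
  have /truncn_itv/andP[] : 0 <= wt u v / scale_unit j by rewrite divr_ge0 // ltW.
  rewrite -/(rounded j u v) ler_pdivlMr // ltr_pdivrMr // -natr1; nra.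
apply/andP; split.
  rewrite /r natr_sum mulr_sumr; apply: ler_sum => u _.
  by rewrite natr_sum mulr_sumr; apply: ler_sum => v _; case/andP: (bnd u v).
apply: (@le_trans _ _ (\sum_(u in S) \sum_(v in ~: S)
                        (scale_unit j * (rounded j u v)%:R + scale_unit j))).
  by apply: ler_sum => u _; apply: ler_sum => v _; case/andP: (bnd u v).
under eq_bigr do rewrite big_split /= -mulr_sumr -natr_sum.
rewrite big_split /= -mulr_sumr -natr_sum lerD2l.
rewrite !sumr_const -mulrnA -[leLHS]mulr_natr.
apply: ler_wpM2l; first exact: ltW.
by rewrite ler_nat -mulnn leq_mul // max_card.
Qed.

End Hierarchy.

(** * The sketch *)

Section Sketch.
Variables (R : realType) (V : finType) (v0 : V) (J L m M : nat) (B : R).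

(* Keys of the three kinds of entries of a message: a merge of components, the
   cluster and degree of a vertex, and a sampled edge. *)
Definition entry : finType :=
  ('I_J * V + ('I_J * 'I_L * V + 'I_J * 'I_L * V * V))%type.

Definition message : finType := {ffun entry -> V * 'I_M.+1}.

Definition blank : V * 'I_M.+1 := (v0, ord0).

(** A nonzero second component marks a merge record; [blank] has 0 there. *)
Definition separates (f : message) (S : {set V}) (j : 'I_J) :=
  [exists v, ((f (inl (j, v))).2 != ord0) && ((v \in S) != ((f (inl (j, v))).1 \in S))].

(** The highest separated merge locates the heaviest cut edge: it forces a cut edge of weight at
    least [B ^ j], and the absence of higher ones excludes [B ^ j.+1]. *)
Definition top_level (f : message) S : option 'I_J :=
  [pick j | separates f S j && [forall i : 'I_J, separates f S i ==> (i <= j)%N]].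

Definition message_estimate (f : message) S : R :=
  if top_level f S is Some j then
    scale_unit B j * \sum_k cluster_estimate R m
      (fun v => (f (inr (inl (j, k, v)))).2 : nat)
      (fun v => (f (inr (inl (j, k, v)))).1)
      (fun u v => (f (inr (inr (j, k, u, v)))).2 : nat) S
  else 0.

Lemma top_level_none f S : top_level f S = None -> forall j, ~~ separates f S j.
Proof.
rewrite /top_level; case: pickP => // none _ j; apply/negP => jS.
have := none [arg max_(i > j | separates f S i) i]%N.
case: arg_maxnP => // i iS imax /negP[].
by rewrite iS; apply/forallP => k; apply/implyP => /imax.
Qed.

Variables (wt : V -> V -> R) (g : 'I_J -> 'I_L -> V -> V -> nat)
  (c : 'I_J -> 'I_L -> V -> V).

Definition sketch_message (w : {ffun 'I_J * 'I_L * V * V -> bool}) : message :=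
  [ffun x : entry => match x with
   | inl (j, v) => if merges wt B j v then (rep wt B j v, inord 1) else blank
   | inr (inl (j, k, v)) => (c j k v, inord (degree (g j k) v))
   | inr (inr (j, k, u, v)) => (v0, inord (sampled_weight g w j k u v))
   end].

Hypothesis M0 : (0 < M)%N.
Hypothesis g_le : forall j k u v, (g j k u v <= degree (contracted wt B j) u)%N.
Hypothesis degree_le : forall j k u,
  (degree (g j k) u <= degree (contracted wt B j) u)%N.
Hypothesis degree_max : forall j u, (degree (contracted wt B j) u <= M)%N.
Hypothesis c_blank : forall j k u, degree (g j k) u = 0%N -> c j k u = v0.

Lemma separates_message w S j : separates (sketch_message w) S j =
  [exists v, merges wt B j v && ((v \in S) != (rep wt B j v \in S))].
Proof.
apply: eq_existsb => v; rewrite ffunE; case: ifP => // _ /=.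
have -> // : inord 1 != ord0 :> 'I_M.+1.
by apply/eqP => /(congr1 val); rewrite /= inordK.
Qed.

Lemma message_estimateE w S : message_estimate (sketch_message w) S =
  if top_level (sketch_message w) S is Some j then
    scale_unit B j * \sum_k cluster_estimate R m (degree (g j k)) (c j k)
                       (sampled_weight g w j k) S
  else 0.
Proof.
rewrite /message_estimate; case: top_level => // j; congr (_ * _).
apply: eq_bigr => k _; congr (cluster_estimate _ _ _ _ _ _).
- apply/funext => v; rewrite ffunE /= inordK // ltnS.
  exact: leq_trans (degree_le j k v) (degree_max j v).
- by apply/funext => v; rewrite ffunE.
- apply/funext => u; apply/funext => v; rewrite ffunE /= inordK // ltnS.
  apply: leq_trans (degree_max j u); apply: leq_trans (g_le j k u v).
  by rewrite /sampled_weight; case: (w _); rewrite ?mul1n.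
Qed.

Lemma message_support w :
  (#|[set x | sketch_message w x != blank]| <=
   \sum_(j < J) #|[set v | merges wt B j v]| +
   (\sum_(j < J) \sum_(k < L) #|[set v | degree (g j k) v != 0]| +
    #|[set i | w i]|))%N.
Proof.
have cardE (T : finType) (P : pred T) : #|[set x | P x]| = (\sum_x P x)%N.
  rewrite -sum1_card big_mkcond; apply: eq_bigr => x _.
  by rewrite inE; case: (P x).
rewrite cardE !big_sumType /=; apply: leq_add; last apply: leq_add.
- under [leqRHS]eq_bigr do rewrite cardE.
  rewrite pair_bigA; apply: leq_sum => -[j v] _ /=; rewrite ffunE.
  by case: ifP => _; rewrite ?leq_b1 // eqxx.
- under [leqRHS]eq_bigr do under eq_bigr do rewrite cardE.
  rewrite !pair_bigA; apply: leq_sum => -[[j k] v] _ /=; rewrite ffunE.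
  by case: (eqVneq (degree (g j k) v) 0%N) => [d0|_]; rewrite ?leq_b1 // c_blank // d0
    /blank; case: eqP => // -[]; congr (_, _); apply/val_inj; rewrite /= inordK.
- rewrite cardE; apply: leq_sum => -[[[j k] u] v] _; rewrite ffunE /sampled_weight.
  case: (w _); rewrite ?leq_b1 // mul0n /blank.
  by case: eqP => // -[]; congr (_, _); apply/val_inj; rewrite /= inordK.
Qed.

End Sketch.

(** The lower side amounts to [(1 + 4 * eps) * (1 - 2 * eps) >= 1], true for [eps] up to [1 / 4]. *)
Lemma approximation_of_error (R : realType) (eps x a : R) : 0 < a -> 0 < eps ->
  eps <= 1 / 30 -> `|x - a| <= 2 * eps * a -> Defs.approximation (1 + 4 * eps) x a.
Proof.
move=> a0 e0 e30; rewrite ler_norml => /andP[lo hi].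
have rho0 : 0 < 1 + 4 * eps by lra.
apply/and3P; split => //; first by nra.
rewrite ler_pdivlMr // ler_pdivrMr // -[X in X <= x]mulrC ler_pdivrMr //.
by apply/andP; split; nra.
Qed.

Lemma fdist_inhabited (R : realType) (T : finType) (x : T) :
  exists d : fdist R T, True.
Proof.
have p01 (i : unit) : 0 <= (0 : R) <= 1 by rewrite lexx ler01.
by exists (pushforward_dist (fun=> x) (bernoulli_dist p01)).
Qed.

(** * Correctness of the sketch *)

Section SketchCorrectness.
Variables (R : realType) (V : finType) (v0 : V) (J L m q : nat) (W eps : R).
Let n := #|V|.
(** With this base, rounding errors on [n ^ 2] pairs total at most [B ^ j / n], within [eps] of the
    cut. Each rounded weight is at most [B ^ 2 = n ^ 6], so [M] bounds the total of every contracted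
    graph. *)
Let B : R := n%:R ^+ 3.
Let M := (n ^ 8)%N.
Hypothesis t0 : (0 < trunc_log 2 n)%N.
Hypothesis tq : (4 * trunc_log 2 n <= q)%N.
Hypothesis nL : (M < 2 ^ L)%N.
Hypothesis WJ : W < B ^+ J.
Hypothesis m0 : (0 < m)%N.
Hypothesis qm : 3 * q%:R <= eps * m%:R.
Hypothesis n_eps : 1 / n%:R <= eps.
Hypothesis eps30 : eps <= 1 / 30.

Let n0 : (0 < n)%N. Proof. by apply/card_gt0P; exists v0. Qed.
Let n0R : 0 < n%:R :> R. Proof. by rewrite ltr0n. Qed.
Let B1 : 1 <= B. Proof. by rewrite exprn_ege1 // ler1n. Qed.
Let eps0 : 0 < eps. Proof. by apply: lt_le_trans n_eps; rewrite divr_gt0. Qed.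

(** Nine times the bound on the expected number of samples, for Markov's inequality. *)
Definition sample_budget := (9 * (2 * m * (L * (6 * n))))%N.

Definition message_budget := (n + (L * (6 * n) + sample_budget))%N.

Lemma sketch_message_correct (G : wgraph R V) : weights_in_range W G ->
  exists (d : fdist R {ffun 'I_J * 'I_L * V * V -> bool})
         (f : {ffun 'I_J * 'I_L * V * V -> bool} -> message V J L M),
  forall S : {set V},
    7 / 9 <= prob d (fun w =>
      (#|[set x | f w x != blank v0 M]| <= message_budget)%N &&
      good_estimate (1 + 4 * eps) (message_estimate m B (f w) S) (cut_weight G S)).
Proof.
move=> GW; pose wt := pair_weight G.
have wtC u v : wt u v = wt v u by apply: pair_weightC.
have wt_ge0 u v : 0 <= wt u v by apply: pair_weight_ge0.
have wt_range u v : 0 < wt u v -> 1 <= wt u v <= W by exact: pair_weight_range.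
have tot j : (total_weight (contracted wt B j) <= M)%N.
  have -> : M = (n ^ 2 * n ^ 6)%N by rewrite -expnD.
  by apply: contracted_total => //; rewrite /B -exprM natrX.
pose P (j : 'I_J) (gc : ('I_L -> V -> V -> nat) * ('I_L -> V -> V)) :=
  [/\ forall u v, (\sum_k gc.1 k u v)%N = contracted wt B j u v,
      forall k u v, gc.1 k u v = gc.1 k v u,
      forall k u v, (0 < gc.1 k u v)%N -> gc.2 k u = gc.2 k v,
      forall k u, degree (gc.1 k) u = 0%N -> gc.2 k u = v0
    & forall k, is_expander q (gc.1 k) (gc.2 k)].
have [gc gcP] : {gc & forall j, P j (gc j)}.
  apply: choice => j.
  have [||//|//|g [c H]] := @expander_hierarchy V v0 q L (contracted wt B j).
  - exact: contractedC.
  - by [].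
  - exact: leq_ltn_trans (tot j) nL.
  - by exists (g, c).
pose g j := (gc j).1; pose c j := (gc j).2.
have gsum j u v : (\sum_k g j k u v)%N = contracted wt B j u v.
  by case: (gcP j) => H _ _ _ _; apply: H.
have gC j k u v : g j k u v = g j k v u by case: (gcP j) => _ H _ _ _; apply: H.
have gcc j k u v : (0 < g j k u v)%N -> c j k u = c j k v 
  by case: (gcP j) => _ _ H _ _; apply: H.
have c0 j k u : degree (g j k) u = 0%N -> c j k u = v0 
  by case: (gcP j) => _ _ _ H _; apply: H.
have gexp j k : is_expander q (g j k) (c j k) by case: (gcP j) => _ _ _ _; apply.
have deg_le j k u : (degree (g j k) u <= degree (contracted wt B j) u)%N.
  by apply: leq_sum => v _; rewrite -gsum (bigD1 k) //= leq_addr.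
have g_le j k u v : (g j k u v <= degree (contracted wt B j) u)%N.
  by apply: leq_trans (deg_le j k u); rewrite /degree (bigD1 v) //= leq_addr.
have deg_max (j : nat) u : (degree (contracted wt B j) u <= M)%N.
  by apply: leq_trans (tot j); rewrite /total_weight (bigD1 u) //= leq_addr.
have M0 : (0 < M)%N by rewrite expn_gt0 n0.
have active : (\sum_(j < J) \sum_(k < L) #|[set v | degree (g j k) v != 0%N]|
               <= L * (6 * n))%N.
  apply: leq_trans (leq_mul (leqnn L) (sum_card_active wtC wt_range B1 J)).
  rewrite big_distrr; apply: leq_sum => j _ /=.
  rewrite -[L in leqRHS]card_ord -sum_nat_const; apply: leq_sum => k _.
  apply: subset_leq_card; apply/fintype.subsetP => v; rewrite !inE.
  by apply: contra => /eqP d0; rewrite -leqn0 -d0.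
exists (bernoulli_dist (sampling_prob01 R m g)), (sketch_message v0 M B wt g c) => S.
set d := bernoulli_dist _; set msg := sketch_message _ _ _ _ _ _.
pose many (w : {ffun 'I_J * 'I_L * V * V -> bool}) :=
  (sample_budget%:R : R) <= #|[set i | w i]|%:R.
have many_le : prob d many <= 1 / 9.
  have L0 : (0 < L)%N by move: nL M0; case: (L) => //; rewrite expn0; lia.
  have b0 : 0 < sample_budget%:R :> R by rewrite ltr0n !muln_gt0 m0 L0 n0.
  apply: le_trans (markov_ineq _ _ b0) _; first by move=> w; apply: ler0n.
  rewrite expect_bernoulli_count ler_pdivrMr //.
  apply: le_trans (sum_sampling_prob _ _ gC) _.
  have -> : 1 / 9 * sample_budget%:R = (2 * m * (L * (6 * n)))%:R :> R.
    by rewrite /sample_budget natrM mulrA div1r mulVf ?mul1r // pnatr_eq0.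
  by rewrite ler_nat leq_mul2l active orbT.
have few w : ~~ many w -> (#|[set x | msg w x != blank v0 M]| <= message_budget)%N.
  rewrite /many ler_nat -ltnNge => /ltnW few.
  apply: leq_trans (message_support _ _ _ c0 _) _; rewrite // /message_budget.
  by rewrite !leq_add // sum_card_merges.
(* Merge records carry no randomness, so the scale chosen for [S] is the same for every sample. *)
have [[j lvl]|none] : (exists j, forall w, top_level (msg w) S = Some j) \/
                      (forall w, top_level (msg w) S = None).
  have lvlE w w' : top_level (msg w) S = top_level (msg w') S.
    by apply: eq_pick => j; rewrite !separates_message //; congr (_ && _);
      apply: eq_forallb => i; rewrite !separates_message.
  case E : (top_level (msg [ffun=> true]) S) => [j|].
    by left; exists j => w; rewrite (lvlE _ [ffun=> true]).
  by right=> w; rewrite (lvlE _ [ffun=> true]).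
- have [jS jmax] : (exists v, merges wt B j v && ((v \in S) != (rep wt B j v \in S))) /\
      forall i v, (j.+1 <= i < J)%N -> merges wt B i v -> (v \in S) = (rep wt B i v \in S).
    have := lvl [ffun=> true]; rewrite /top_level; case: pickP => // i /andP[+ imax] [ij].
    rewrite {}ij in imax *; rewrite separates_message // => /existsP jS.
    split=> // i' v /andP[ji iJ] iv; apply/eqP/negPn/negP => sep.
    have /implyP := forallP imax (Ordinal iJ); rewrite separates_message //=.
    rewrite leqNgt ji => H; apply: notF; apply: H.
    by apply/existsP; exists v; rewrite iv.
  (* No merge above [j] separates [S], so [S] is a union of components of scale [j.+1] and
     contraction preserves its cut. *)
  have resp := rep_respected wtC wt_range B1 WJ (ltn_ord j) jmax.
  have [v /andP[_ sep]] := jS.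
  have [u uS [x xS ux]] := merge_separated wtC sep.
  set cut := cut_weight G S; have cutE : cut = _ := cut_weightE G S.
  have cut_ge : B ^+ j <= cut.
    apply: (le_trans ux); rewrite cutE (bigD1 u) //= (bigD1 x) //= -addrA lerDl.
    by rewrite addr_ge0 ?sumr_ge0 // => y _; apply: sumr_ge0.
  pose r := (\sum_(u in S) \sum_(v in ~: S) rounded wt B j u v)%N.
  have := rounded_cut_bounds wt_ge0 B1 j S; rewrite -/r -cutE => /andP[r_le le_r].
  have Bj0 : 0 < B ^+ j by rewrite exprn_gt0 // (lt_le_trans ltr01).
  have U0 : 0 < scale_unit B j by rewrite scale_unit_gt0.
  have small : scale_unit B j * (#|V| ^ 2)%:R <= eps * cut.
    have -> : scale_unit B j * (#|V| ^ 2)%:R = 1 / n%:R * B ^+ j.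
      by rewrite /scale_unit /B natrX; field; rewrite gt_eqF.
    by apply: ler_pM => //; rewrite ?divr_ge0 // ltW.
  have cut0 : 0 < cut by apply: lt_le_trans cut_ge.
  have gcut : (\sum_k \sum_(u in S) \sum_(v in ~: S) g j k u v)%N = r.
    rewrite /r -(contracted_cut resp) exchange_big; apply: eq_bigr => y _.
    by rewrite exchange_big; apply: eq_bigr => z _; rewrite gsum.
  (* If [r = 0], the cut is at most its own rounding error [eps * cut], which is impossible. *)
  have r0 : (0 < r)%N.
    rewrite lt0n; apply/eqP => r0; move: le_r; rewrite r0 mulr0 add0r.
    by have := ler_wpM2r (ltW cut0) eps30; lra.
  pose far w := eps * r%:R < `|\sum_k cluster_estimate R m (degree (g j k)) (c j k)
    (sampled_weight g w j k) S - r%:R|.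
  have conc := @sampled_estimate_concentration _ _ _ _ _ _ _ gC gcc q j S eps
                 m0 (gexp j) eps0 qm.
  rewrite gcut in conc; have {}conc : prob d far <= 1 / 9 := conc r0.
  apply: (@le_trans _ _ (1 - prob d many - prob d far)).
    by move: (prob d many) (prob d far) many_le conc => p1 p2; lra.
  apply: prob_avoid2.
    move=> w /few -> /=; rewrite /good_estimate gt_eqF // /far -leNgt => near.
    apply: approximation_of_error => //; rewrite message_estimateE //.
    have -> : top_level (sketch_message v0 M B wt g c w) S = Some j := lvl w.
    (* The error splits into a sampling part and a rounding part, each at most [eps * cut]. *)
    rewrite -(subrK (scale_unit B j * r%:R) (_ * _)) -addrA.
    apply: (le_trans (ler_normD _ _)); rewrite -mulrBr normrM (gtr0_norm U0).
    have d1 : scale_unit B j * `|\sum_k cluster_estimate R m (degree (g j k)) (c j k)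
        (sampled_weight g w j k) S - r%:R| <= eps * cut.
      apply: le_trans (ler_wpM2l (ltW U0) near) _.
      by rewrite mulrCA ler_wpM2l // ltW.
    have d2 : `|scale_unit B j * r%:R - cut| <= eps * cut.
      by rewrite distrC ger0_norm ?subr_ge0 //; lra.
    by move: d1 d2; lra.
- apply: (@le_trans _ _ (1 - prob d many - prob d (fun=> false))).
    have -> : prob d (fun=> false) = 0 by rewrite /prob big_pred0_eq.
    by move: (prob d many) many_le => p1; lra.
  apply: prob_avoid2 => w /few -> _ /=; rewrite message_estimateE //.
  have -> : top_level (sketch_message v0 M B wt g c w) S = None := none w.
  rewrite /good_estimate; suff -> : cut_weight G S = 0 by rewrite eqxx.
  (* Without any separated merge, [S] is a union of components of scale 0. These contain every edge
     of nonzero weight, so the cut is 0, as is the estimate. *)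
  have resp : forall v, (rep wt B 0 v \in S) = (v \in S).
    apply: (rep_respected wtC wt_range B1 WJ (leq0n J)) => i v iJ iv.
    apply/eqP/negPn/negP => sep.
    have := top_level_none (none w) (Ordinal iJ); rewrite separates_message //.
    by case/existsP; exists v; rewrite iv.
  rewrite cut_weightE big1 // => u uS; rewrite big1 // => v vS.
  apply/eqP; rewrite eq_le wt_ge0 andbT leNgt; apply/negP => /wt_range/andP[uv1 _].
  have /rep_eq E : connect (linked wt B 0) u v by apply: connect1; rewrite /linked expr0.
  by move: vS; rewrite inE -resp -E // resp uS.
Qed.
(** Decoding is faithful for messages within the budget; oversized ones already count as failures in
    the bound [7 / 9]. *)
Lemma cut_sketch_exists s : (0 < J)%N ->
  ((#|entry V J L| * #|{: V * 'I_M.+1}|) ^ message_budget <= 2 ^ s)%N ->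
  exists sk : cut_sketch R V s, forall G : wgraph R V, weights_in_range W G ->
    forall S : {set V}, 7 / 9 <= prob (sketch sk G)
      (fun x => good_estimate (1 + 4 * eps) (estimate sk x S) (cut_weight G S)).
Proof.
move=> J0 Hs; pose x0 : entry V J L := inl (Ordinal J0, v0).
have [enc [dec decK]] := sparse_encoding x0 (blank v0 M) Hs.
pose est x S := message_estimate m B (dec x) S.
pose P (G : wgraph R V) (d : fdist R (s.-tuple bool)) := weights_in_range W G ->
  forall S : {set V}, 7 / 9 <= prob d
    (fun x => good_estimate (1 + 4 * eps) (est x S) (cut_weight G S)).
have [sk skP] : {sk & forall G, P G (sk G)}.
  (* Graphs with weights out of range receive an arbitrary law. *)
  apply: choice => G; have [GW|nGW] := pselect (weights_in_range W G); last first.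
    by have [d _] := fdist_inhabited R [tuple of nseq s true]; exists d.
  have [d [f H]] := sketch_message_correct GW.
  exists (pushforward_dist (fun w => enc (f w)) d) => _ S.
  rewrite prob_pushforward; apply: le_trans (H S) _; apply: prob_le => w.
  by case/andP => /decK; rewrite /est => ->.
by exists (CutSketch sk est).
Qed.
End SketchCorrectness.

(** * Size of the sketch *)

Lemma ln2_ge_half (R : realType) : 1 / 2 <= ln 2 :> R.
Proof.
have := @le_ln1Dx R (- (1 / 2)); rewrite (_ : 1 + - (1 / 2) = 2^-1 :> R); last by lra.
by rewrite lnV ?posrE // => H; have := H ltac:(lra); lra.
Qed.

Lemma trunc_log_le_ln (R : realType) n : (0 < n)%N ->
  (trunc_log 2 n)%:R <= 2 * ln n%:R :> R.
Proof.
move=> n0; have : ln ((2 ^ trunc_log 2 n)%N%:R) <= ln n%:R :> R.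
  by rewrite ler_ln ?posrE ?ltr0n ?expn_gt0 // ler_nat trunc_logP.
rewrite natrX lnXn // -[X in X <= _ -> _]mulr_natl.
by have := ler_wpM2l (ler0n R (trunc_log 2 n)) (ln2_ge_half R); lra.
Qed.

(** With [x = ln W]: for [x <= 2] the truncation at 1 suffices, and for larger [x] one has
    [x + 1 <= x ^ 2]. *)
Lemma ln_succ_le_loglog (R : realType) (W : R) : 1 <= W ->
  ln (ln W + 1) <= 2 * loglog W.
Proof.
rewrite /loglog => W1; have := ln_ge0 W1; move: (ln W) => x x0.
have m1 : 1 <= Num.max 1 (ln x) by rewrite le_max lexx.
have [x2|x2] := leP x 2.
  have le : ln (x + 1) <= x by rewrite addrC le_ln1Dx //; lra.
  by lra.
have mx : ln x <= Num.max 1 (ln x) by rewrite le_max lexx orbT.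
have xp : 0 < x by lra.
apply: (@le_trans _ _ (ln (x ^+ 2))).
  by rewrite ler_ln ?posrE ?exprn_gt0 //; [nra | lra].
by rewrite lnXn // mulr2n; lra.
Qed.

(** The product is at most [18 * J * n ^ 12], and [n >= 30] absorbs the constant. An entry thus
    costs about [log J + 13 * log n] bits. *)
Lemma entry_alphabet_bound (n t J L : nat) : (30 <= n)%N -> (t < n)%N ->
  L = (8 * t.+1)%N ->
  ((J * n + (J * L * n + J * L * n * n)) * (n * (n ^ 8).+1) <= J * n ^ 13)%N.
Proof.
move=> n30 tn ->.
have K : (J * n + (J * (8 * t.+1) * n + J * (8 * t.+1) * n * n) <= J * (9 * n ^ 3))%N.
  have -> : (J * n + (J * (8 * t.+1) * n + J * (8 * t.+1) * n * n)
    = J * (n * (1 + 8 * t.+1 + 8 * t.+1 * n)))%N by lia.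
  rewrite leq_mul2l; apply/orP; right.
  have -> : (9 * n ^ 3 = n * (9 * (n * n)))%N by rewrite !expnS expn0; lia.
  rewrite leq_mul2l; apply/orP; right; nia.
have D : (n * (n ^ 8).+1 <= 2 * n ^ 9)%N.
  have := expn_gt0 n 8; rewrite (leq_trans _ n30) //= => n8.
  by rewrite [(n ^ 9)%N]expnS mulnCA leq_mul2l; apply/orP; right; lia.
apply: leq_trans (leq_mul K D) _; rewrite -mulnA leq_mul2l; apply/orP; right.
have -> : (9 * n ^ 3 * (2 * n ^ 9) = 18 * n ^ 12)%N.
  by rewrite mulnACA -expnD.
by rewrite expnS leq_mul2r (leq_trans _ n30) ?orbT.
Qed.

(** The number of entries is at most [2000 * m * n * t] with [m <= 13 * t / eps]; the bits per entry
    are at most [(5 + 26) * t * LL]. *)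
Lemma sketch_size_bound (R : realType) (n t m N a L : nat) (eps LL : R) :
  (1 <= n)%N -> (1 <= t)%N -> L = (8 * t.+1)%N -> 0 < eps -> eps <= 1 -> 1 <= LL ->
  N = (n + (L * (6 * n) + 9 * (2 * m * (L * (6 * n)))))%N -> (1 <= m)%N ->
  m%:R <= 12 * t%:R / eps + 1 -> a%:R <= 5 * LL ->
  (N * (a + 13 * t.+1))%:R <= (2000 * 13 * 31) * t%:R ^+ 3 * (n%:R / eps * LL).
Proof.
move=> n1 t1 -> e0 e1 LL1 -> m1 mle ale.
have T1 : 1 <= t%:R :> R by rewrite ler1n.
have n1R : 1 <= n%:R :> R by rewrite ler1n.
have m13 : m%:R <= 13 * t%:R / eps.
  apply: le_trans mle _; rewrite -lerBrDl -mulrBl -mulrBl.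
  by rewrite ler_pdivlMr //; lra.
have N1 : (n + (8 * t.+1 * (6 * n) + 9 * (2 * m * (8 * t.+1 * (6 * n))))
           <= 2000 * (m * n * t))%N.
  have H1 : (n <= m * n * t)%N by rewrite -mulnA mulnCA leq_pmulr // muln_gt0 m1.
  have H2 : (t.+1 * n <= 2 * (n * t))%N by rewrite mulnC mulnCA leq_mul2l; lia.
  have H3 : (n * t <= m * n * t)%N by rewrite -mulnA leq_pmull.
  have H4 : (m * (t.+1 * n) <= 2 * (m * n * t))%N.
    by rewrite -mulnA [leqRHS]mulnCA leq_mul2l H2 orbT.
  by move: H1 H2 H3 H4; clear; lia.
have N2 : (2000 * (m * n * t))%:R <= (2000 * 13) * t%:R ^+ 2 * (n%:R / eps) :> R.
  rewrite !natrM.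
  have -> : 2000 * 13 * t%:R ^+ 2 * (n%:R / eps) = 2000 * (13 * t%:R / eps * n%:R * t%:R) :> R.
    by ring.
  apply: ler_wpM2l; first exact: ler0n.
  by do 2!(apply: ler_wpM2r; first exact: ler0n).
have b31 : (a + 13 * t.+1)%:R <= 31 * t%:R * LL.
  rewrite natrD natrM -natr1; nra.
rewrite natrM; apply: le_trans (ler_pM _ _ (le_trans _ N2) b31) _ => //.
  by rewrite ler_nat.
by rewrite le_eqVlt; apply/orP; left; apply/eqP; ring.
Qed.

Theorem theorem3p1 (R : realType) :
  exists (C K : R) (c : nat), 0 < C /\ 0 < K /\
    forall (n : nat) (V : finType) (W eps : R),
      (0 < n)%N -> #|V| = n -> 1 <= W -> 1 / n%:R <= eps -> eps <= 1 / 30 ->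
      exists (s : nat) (sk : cut_sketch R V s),
        s%:R <= K * ln n%:R ^+ c * (n%:R / eps * loglog W) /\
        forall G : wgraph R V, weights_in_range W G ->
          forall S : {set V},
            7 / 9 <= prob (sketch sk G)
              (fun x => good_estimate (1 + C * eps) (estimate sk x S)
                          (cut_weight G S)).
Proof.
(* The 4 is the accuracy loss in [approximation_of_error]; the factor 8 comes from cubing
   [t <= 2 * ln n]. *)
exists 4, (2000 * 13 * 31 * 8), 3%N; split; first by lra.
split; first by lra.
move=> n V W eps n0 Vn W1 n_eps eps30.
have nR : 0 < n%:R :> R by rewrite ltr0n.
have eps0 : 0 < eps by apply: lt_le_trans n_eps; rewrite divr_gt0.
have n30 : (30 <= n)%N.
  rewrite -(ler_nat R); have := le_trans n_eps eps30.
  by rewrite ler_pdivrMr //; lra.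
pose t := trunc_log 2 n.
have t1 : (1 <= t)%N by rewrite trunc_log_gt0; lia.
have tlt : (t < n)%N by apply: leq_trans (ltn_expl t _) (trunc_logP _ n0).
have t_ln : t%:R <= 2 * ln n%:R :> R by exact: trunc_log_le_ln.
(* [L] gives [n ^ 8 < 2 ^ L]; [m] exceeds [3 * q / eps]; [J] exceeds [ln W], which suffices for
   [W < B ^ J] since [ln B >= 1]. *)
pose L := (8 * t.+1)%N; pose q := (4 * t)%N.
pose m := (Num.truncn (12 * t%:R / eps)).+1.
pose J := (Num.truncn (ln W)).+1.
have /truncn_itv/andP[J_le J_gt] := ln_ge0 W1.
have /truncn_itv/andP[m_le m_gt] : 0 <= 12 * t%:R / eps.
  by rewrite divr_ge0 ?mulr_ge0 // ltW.
have [v0 _] : exists v0 : V, v0 \in V by apply/card_gt0P; rewrite Vn.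
pose a := (trunc_log 2 J).+1; pose N := message_budget V L m.
have lnB : 1 <= ln (n%:R ^+ 3) :> R.
  have T1 : 1 <= t%:R :> R by rewrite ler1n.
  by rewrite lnXn // -[leRHS]mulr_natl; lra.
have nn_t : (n < 2 ^ t.+1)%N by apply: trunc_log_ltn.
have m0 : (0 < m)%N by []; have J0 : (0 < J)%N by [].
have qm : 3 * q%:R <= eps * m%:R.
  have /ltW := m_gt; rewrite ler_pdivrMr // [leRHS]mulrC; apply: le_trans.
  by rewrite /q natrM mulrA; lra.
have e1 : eps <= 1 by lra.
have LL1 : 1 <= loglog W by rewrite /loglog le_max lexx.
have mle : m%:R <= 12 * t%:R / eps + 1 by rewrite /m -natr1 lerD2r.
have ale : a%:R <= 5 * loglog W.
  have lnJ : ln J%:R <= ln (ln W + 1) :> R.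
    rewrite ler_ln ?posrE ?ltr0n // -?natr1 ?lerD2r //.
    by rewrite ltr_wpDl // ln_ge0.
  have := trunc_log_le_ln R J0; have := ln_succ_le_loglog W1.
  by rewrite /a -natr1; lra.
have card_alphabet : ((#|entry V J L| * #|{: V * 'I_(n ^ 8).+1}|) ^ N
                      <= 2 ^ (N * (a + 13 * t.+1)))%N.
  rewrite [(N * _)%N]mulnC expnM leq_exp2r; last by rewrite /N /message_budget Vn ltn_addr.
  rewrite /entry !card_sum !card_prod !card_ord Vn.
  apply: leq_trans (entry_alphabet_bound _ n30 tlt (erefl L)) _.
  rewrite expnD [(13 * _)%N]mulnC expnM; apply: leq_mul; first exact/ltnW/trunc_log_ltn.
  by rewrite leq_exp2r // ltnW.
have tq : (4 * trunc_log 2 n <= q)%N by [].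
have nL : (n ^ 8 < 2 ^ L)%N by rewrite /L [(8 * _)%N]mulnC expnM ltn_exp2r.
have WJ : W < (n%:R ^+ 3) ^+ J.
  rewrite -ltr_ln ?posrE ?exprn_gt0 //; last exact: lt_le_trans W1.
  rewrite lnXn ?exprn_gt0 // -[ltRHS]mulr_natl; apply: lt_le_trans J_gt _.
  by rewrite -[leLHS]mulr1; apply: ler_wpM2l.
subst n; exists (N * (a + 13 * t.+1))%N.
have [sk skP] := cut_sketch_exists v0 t1 tq nL WJ m0 qm n_eps eps30 J0 card_alphabet.
exists sk; split => //.
have cube A X : 0 <= A -> 0 <= X ->
    A * t%:R ^+ 3 * X <= A * 8 * ln #|V|%:R ^+ 3 * X :> R.
  move=> A0 X0; rewrite -[X in _ <= X * _]mulrA; apply: ler_wpM2r => //.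
  apply: ler_wpM2l => //; rewrite (_ : 8 = 2 ^+ 3) -?exprMn; last by ring.
  by rewrite lerXn2r // nnegrE ?mulr_ge0 ?ln_ge0 // ler1n.
have size_le := sketch_size_bound n0 t1 (erefl L) eps0 e1 LL1 (erefl N) m0 mle ale.
apply: (le_trans size_le); apply: cube; first by rewrite !mulr_ge0 ?ler0n.
by rewrite mulr_ge0 ?divr_ge0 ?ler0n ?(ltW eps0) ?(le_trans ler01).
Qed.
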